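(* Let $x:M^2\to\mathbb{R}^n$ be a super-conformal minimal surface. Then the pedal surfaces of $x$ are a family of adjoint transforms of $x$ depending on the choice of the pedal point, i.e. on $n$ real parameters: for every $x_0\in\mathbb{R}^n$, the pedal surface of $x$ with respect to the pedal point $x_0$ is an adjoint transform of $x$.
   Context: The dot product is the Euclidean inner product of $\mathbb{R}^n$ extended complex bilinearly to $\mathbb{C}^n$; $z$ is a local complex coordinate of the Riemann surface $M$. A super-conformal minimal surface is a conformal minimal immersion ($x_z\cdot x_z=0$, $x_{z\bar z}=0$, $x_z\cdot x_{\bar z}>0$) with $x_{zz}\cdot x_{zz}\equiv0$. The pedal surface with pedal point $x_0$ assigns to $p\in M$ the foot of the perpendicular from $x_0$ to the affine tangent plane of $x$ at $x(p)$: $$\hat x=x-\frac{(x-x_0)\cdot x_{\bar z}}{x_z\cdot x_{\bar z}}x_z-\frac{(x-x_0)\cdot x_z}{x_z\cdot x_{\bar z}}x_{\bar z}.$$ Maps into $\mathbb{R}^n$ are regarded as maps into $S^n=\mathbb{R}^n\cup\{\infty\}$ by inverse stereographic projection. Adjoint transforms are defined as follows. Let $\mathbb{R}^{n+2}_1$ be $\mathbb{R}^{n+2}$ with $\langle Y,Y\rangle=\sum_{i=1}^{n+1}Y_i^2-Y_{n+2}^2$, extended complex bilinearly, and identify $S^n$ with the projectivized light cone by $y\leftrightarrow[(y,1)]$. For a conformal immersion $y:M\to S^n$ with local coordinate $z$, the canonical lift $Y$ is the (forward) light-cone-valued lift, $y=[Y]$, with $\langle Y_z,Y_{\bar z}\rangle=\frac12$.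 Let $V=\mathrm{span}\{Y,\mathrm{Re}\,Y_z,\mathrm{Im}\,Y_z,Y_{z\bar z}\}$, $V^\perp$ its orthogonal complement with normal connection $D$, and $N\in V$ the unique section with $\langle N,N\rangle=0$, $\langle N,Y\rangle=-1$, $\langle N,Y_z\rangle=0$. The equation $Y_{zz}=-\frac s2Y+\kappa$ defines the complex function $s$ and $\kappa\in\Gamma(V^\perp\otimes\mathbb{C})$; $y$ is Willmore if $D_{\bar z}D_{\bar z}\kappa+\frac{\bar s}2\kappa=0$ (minimal surfaces in $\mathbb{R}^n$ are Willmore). An adjoint transform of a Willmore immersion $y:M\to S^n$ is a smooth map $\hat y:M\to S^n$ such that on an open dense subset, with respect to local coordinates, $\hat y=[\hat Y]$ with $\hat Y=\frac12|\mu|^2Y+\bar\mu Y_z+\mu Y_{\bar z}+N$ for a smooth local complex function $\mu$ satisfying $\mu_z-\frac12\mu^2-s=0$ and $\langle\eta,\eta\rangle=0$, where $\eta=D_{\bar z}\kappa+\frac{\bar\mu}2\kappa$. An adjoint transform of $x$ means one of its image in $S^n$. *)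

(* Defs.v *)
From HB Require Import structures.
From mathcomp Require Import all_boot all_order all_algebra.
From mathcomp Require Import all_classical all_reals all_analysis.
From mathcomp.real_closed Require Import complex.

Set Implicit Arguments.
Unset Strict Implicit.
Unset Printing Implicit Defensive.

Import Order.TTheory GRing.Theory Num.Theory.
Import numFieldNormedType.Exports.

Local Open Scope classical_set_scope.
Local Open Scope ring_scope.
Local Open Scope complex_scope.

(* A point (u, v) of [R * R] stands for z = u + iv. Complex functions are
   differentiated through their real and imaginary parts, and [dz], [dzb] are
   the Wirtinger derivatives (d/du -/+ i d/dv)/2. *)
Section Calculus.
Variable R : realType.

Fixpoint Ck (k : nat) (U : set (R * R)) (f : R * R -> R) : Prop :=
  match k with
  | 0%N => forall w, U w -> {for w, continuous f}
  | k'.+1 => (forall w, U w -> differentiable f w) /\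
             (forall v : R * R, Ck k' U ('D_v f))
  end.

Definition smooth (U : set (R * R)) (f : R * R -> R) : Prop :=
  forall k, Ck k U f.

Definition csmooth (U : set (R * R)) (f : R * R -> R[i]) : Prop :=
  smooth U (fun w => complex.Re (f w)) /\ smooth U (fun w => complex.Im (f w)).

Definition vsmooth m (U : set (R * R)) (F : R * R -> 'rV[R[i]]_m) : Prop :=
  forall j, csmooth U (fun w => F w 0 j).

Definition cderive (v : R * R) (f : R * R -> R[i]) (w : R * R) : R[i] :=
  ('D_v (fun u => complex.Re (f u)) w) +i* ('D_v (fun u => complex.Im (f u)) w).

Definition dz (f : R * R -> R[i]) (w : R * R) : R[i] :=
  2^-1 * (cderive (1, 0) f w - 'i%C * cderive (0, 1) f w).

Definition dzb (f : R * R -> R[i]) (w : R * R) : R[i] :=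
  2^-1 * (cderive (1, 0) f w + 'i%C * cderive (0, 1) f w).

Definition vdz m (F : R * R -> 'rV[R[i]]_m) (w : R * R) : 'rV[R[i]]_m :=
  \row_j dz (fun u => F u 0 j) w.

Definition vdzb m (F : R * R -> 'rV[R[i]]_m) (w : R * R) : 'rV[R[i]]_m :=
  \row_j dzb (fun u => F u 0 j) w.

(* Cauchy-Riemann equations in the form d(T1 + i T2)/d zbar = 0 *)
Definition holomorphic_on (U : set (R * R)) (T : R * R -> R * R) : Prop :=
  forall w, U w ->
    differentiable T w /\ dzb (fun u => (T u).1 +i* (T u).2) w = 0.

End Calculus.

Definition cplx (R : realType) m n (A : 'M[R]_(m, n)) : 'M[R[i]]_(m, n) :=
  map_mx (real_complex R) A.

(* [cinv c] is total, but is the inverse of [cmap c] only on the image of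
   [cdom c]. *)
Record chart (R : realType) (M : topologicalType) := Chart {
  cdom : set M;
  cmap : M -> R * R;
  cinv : R * R -> M;
  cdom_open : open cdom;
  cimg_open : open (cmap @` cdom);
  cmapK : forall p, cdom p -> cinv (cmap p) = p;
  cmap_continuous : forall p, cdom p -> {for p, continuous cmap};
  cinv_continuous :
    forall w, (cmap @` cdom) w -> {for w, continuous cinv}
}.

Definition coord_image (R : realType) (M : topologicalType) (c : chart R M)
  (A : set M) : set (R * R) := cmap c @` (cdom c `&` A).

(* Second countability is not required: it is automatic (Rado). The atlas is
   arbitrary; in particular it may be the maximal one. *)
Record riemann_surface (R : realType) := RiemannSurface {
  carrier :> topologicalType;
  atlas : set (chart R carrier);
  atlas_cover : forall p : carrier, exists c, atlas c /\ cdom c p;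
  atlas_holomorphic : forall c c', atlas c -> atlas c' ->
    holomorphic_on (coord_image c (cdom c')) (fun w => cmap c' (cinv c w));
  rs_hausdorff : hausdorff_space carrier;
  rs_connected : connected [set: carrier]
}.

Section RiemannSurface.
Variables (R : realType) (M : riemann_surface R).

Definition chart_at (p : M) : chart R M := sval (cid (atlas_cover p)).

(* the image of the coordinate z *)
Definition zdom (c : chart R M) : set (R * R) := coord_image c setT.

Definition local_expr m (c : chart R M) (x : M -> 'rV[R]_m) (w : R * R) :
  'rV[R[i]]_m := cplx (x (cinv c w)).

Definition smooth_map m (x : M -> 'rV[R]_m) : Prop :=
  forall c, atlas c -> vsmooth (zdom c) (local_expr c x).

(* complex bilinear, not Hermitian *)
Definition dot m (u v : 'rV[R[i]]_m) : R[i] := (u *m v^T) 0 0.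

Definition conformal_immersion m (x : M -> 'rV[R]_m) : Prop :=
  smooth_map x /\
  forall c, atlas c -> forall w, zdom c w ->
    let X := local_expr c x in
    dot (vdz X w) (vdz X w) = 0 /\ 0 < dot (vdz X w) (vdzb X w).

Definition minimal_immersion m (x : M -> 'rV[R]_m) : Prop :=
  conformal_immersion x /\
  forall c, atlas c -> forall w, zdom c w ->
    vdzb (vdz (local_expr c x)) w = 0.

Definition superconformal_minimal m (x : M -> 'rV[R]_m) : Prop :=
  minimal_immersion x /\
  forall c, atlas c -> forall w, zdom c w ->
    let X := local_expr c x in
    dot (vdz (vdz X) w) (vdz (vdz X) w) = 0.

Definition pedal_expr m (x : M -> 'rV[R]_m) (x0 : 'rV[R]_m) (c : chart R M)
    (w : R * R) : 'rV[R[i]]_m :=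
  let X := local_expr c x in
  let d := X w - cplx x0 in
  let Xz := vdz X w in
  let Xzb := vdzb X w in
  X w - (dot d Xzb / dot Xz Xzb) *: Xz - (dot d Xz / dot Xz Xzb) *: Xzb.

(* [pedal_expr] is a real vector (its last two terms are conjugate), so that
   [Re] only changes its type; it is invariant under holomorphic changes of
   coordinate, so that the choice made by [chart_at] is immaterial. *)
Definition pedal m (x : M -> 'rV[R]_m) (x0 : 'rV[R]_m) (p : M) : 'rV[R]_m :=
  let c := chart_at p in
  map_mx (@complex.Re R) (pedal_expr x x0 c (cmap c p)).

Definition sphere m (y : 'rV[R]_(m + 1)) : Prop := (y *m y^T) 0 0 = 1.

(* inverse stereographic projection from the pole (0, ..., 0, 1) *)
Definition istereo m (x : 'rV[R]_m) : 'rV[R]_(m + 1) :=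
  let q := (x *m x^T) 0 0 in
  (1 + q)^-1 *: row_mx (2 *: x) (q - 1)%:M.

Definition lorentz_gram (K : fieldType) m : 'M[K]_(m + 1) :=
  block_mx 1%:M 0 0 (- 1)%:M.

Definition lorentz m (u v : 'rV[R[i]]_(m + 1)) : R[i] :=
  (u *m lorentz_gram R[i] m *m v^T) 0 0.

Definition cone m (y : 'rV[R]_(m + 1)) : 'rV[R]_(m + 1 + 1) := row_mx y 1%:M.

Section Frame.
Variable m : nat.
Implicit Types (Y N : R * R -> 'rV[R]_(m + 1 + 1)).
Implicit Types (kappa : R * R -> 'rV[R[i]]_(m + 1 + 1)).

Definition Lz Y : R * R -> 'rV[R[i]]_(m + 1 + 1) := vdz (fun w => cplx (Y w)).
Definition Lzb Y : R * R -> 'rV[R[i]]_(m + 1 + 1) := vdzb (fun w => cplx (Y w)).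

Definition canonical_lift (y : M -> 'rV[R]_(m + 1)) (c : chart R M) Y : Prop :=
  vsmooth (zdom c) (fun w => cplx (Y w)) /\
  forall w, zdom c w ->
    (exists2 r : R, 0 < r & Y w = r *: cone (y (cinv c w))) /\
    lorentz (Lz Y w) (Lzb Y w) = 2^-1.

(* Subspaces are row spaces of matrices. Y_{z zbar} is real, so that [Re] only
   changes its type. *)
Definition Vbundle Y (w : R * R) : 'M[R]_(m + 1 + 1) :=
  (Y w + map_mx (@complex.Re R) (Lz Y w) + map_mx (@complex.Im R) (Lz Y w)
     + map_mx (@complex.Re R) (vdzb (Lz Y) w))%MS.

Definition Vperp Y (w : R * R) : 'M[R]_(m + 1 + 1) :=
  kermx (lorentz_gram R (m + 1) *m (Vbundle Y w)^T).

(* D_{zbar}: the (V^perp (x) C)-component of the derivative *)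
Definition Dzb Y kappa (w : R * R) : 'rV[R[i]]_(m + 1 + 1) :=
  vdzb kappa w *m proj_mx (cplx (Vperp Y w)) (cplx (Vbundle Y w)).

Definition N_section (c : chart R M) Y N : Prop :=
  vsmooth (zdom c) (fun w => cplx (N w)) /\
  forall w, zdom c w ->
    [/\ (N w <= Vbundle Y w)%MS,
        lorentz (cplx (N w)) (cplx (N w)) = 0,
        lorentz (cplx (N w)) (cplx (Y w)) = -1 &
        lorentz (cplx (N w)) (Lz Y w) = 0].

Definition hopf_schwarzian (c : chart R M) Y (s : R * R -> R[i]) kappa : Prop :=
  [/\ csmooth (zdom c) s, vsmooth (zdom c) kappa &
      forall w, zdom c w ->
        (kappa w <= cplx (Vperp Y w))%MS /\
        vdz (Lz Y) w = - (s w / 2) *: cplx (Y w) + kappa w].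

(* Y, s and kappa are uniquely determined over [zdom c] by y and c. *)
Definition willmore (y : M -> 'rV[R]_(m + 1)) : Prop :=
  forall c, atlas c -> exists Y s kappa,
    [/\ canonical_lift y c Y, hopf_schwarzian c Y s kappa &
        forall w, zdom c w ->
          Dzb Y (Dzb Y kappa) w + ((s w)^*%C / 2) *: kappa w = 0].

Definition willmore_immersion (y : M -> 'rV[R]_(m + 1)) : Prop :=
  [/\ forall p, sphere (y p), conformal_immersion y & willmore y].

(* U is the open dense subset. As <Yhat, Y> = -1, mu is determined by yhat, so
   that the local functions mu in one coordinate patch glue together. *)
Definition adjoint_transform (y yhat : M -> 'rV[R]_(m + 1)) : Prop :=
  [/\ willmore_immersion y,
      forall p, sphere (yhat p),
      smooth_map yhat &
      exists U : set M, [/\ open U, dense U &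
        forall c, atlas c -> exists Y N s kappa,
          [/\ canonical_lift y c Y, N_section c Y N,
              hopf_schwarzian c Y s kappa &
              exists2 mu : R * R -> R[i], csmooth (coord_image c U) mu &
                forall w, coord_image c U w ->
                  let eta := Dzb Y kappa w + ((mu w)^*%C / 2) *: kappa w in
                  let Yhat := (2^-1 * (mu w * (mu w)^*%C)) *: cplx (Y w)
                    + (mu w)^*%C *: Lz Y w + mu w *: Lzb Y w + cplx (N w) in
                  [/\ exists2 r : R,
                        r != 0 & Yhat = cplx (r *: cone (yhat (cinv c w))),
                      dz mu w - 2^-1 * (mu w) ^+ 2 - s w = 0 &
                      lorentz eta eta = 0]]]].

End Frame.

End RiemannSurface.

(* Main.v *)
Require Import Defs.
From mathcomp Require Import all_boot all_order all_algebra.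
From mathcomp Require Import all_classical all_reals all_analysis.
From mathcomp.real_closed Require Import complex.
From mathcomp Require Import ring lra.

(* Write [rho = x_z . x_zb], [lam = (2 rho)^(-1/2)], and let
   [G = (x, (|x|^2 - 1)/2, (|x|^2 + 1)/2)] be the paraboloid lift, so that [Y = lam G]
   is the canonical lift and [p = (0, 1, 1)] is the null vector of the point at
   infinity. Minimality gives [G_{z zb} = rho p], and [x_zz] is holomorphic; hence
   [kappa = lam G_zz + 2 lam_z G_z], [s = -2 lam_zz / lam] and
   [D_zb kappa = (lam_zb / lam) kappa]. Thus y is Willmore, and every [eta] is a
   multiple of [kappa], which is null because x is super-conformal.

   With [mu = nu - 2 lam_z / lam] the vector [Yhat] is a multiple of the paraboloid
   lift of [x + (2/nu) x_z + (2/conj nu) x_zb], which is the pedal foot exactly for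
   [nu = - 2 rho / g], [g = (x - x0) . x_zb]; the Riccati equation then reduces to
   [g_z = rho]. The same identity shows that [g] vanishes on no open set. *)

(** The choice of mu linearizes the Riccati equation. One solution is -2 lam_z / lam: its Yhat is p
    / lam, the constant point at infinity, and p lies in V at every point because x is minimal.
    Since rho_z / rho = -2 lam_z / lam, writing another solution as -2 rho / g - 2 lam_z / lam turns
    the quadratic equation into the linear one g_z = rho. A solution is x . x_zb, and it may be
    changed by any function that d/dz annihilates; subtracting x0 . x_zb is such a change, whence
    the n real parameters.

    Where g = 0 the foot is x itself, so Yhat would be a multiple of Y, against <Yhat, Y> = -1: no
    finite mu exists there, and the open dense set has to avoid these points. A second difficulty is
    global: [pedal] selects a chart separately at each point, so its smoothness rests on the
    invariance of the pedal formula under a holomorphic change of coordinate. *)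

Set Implicit Arguments.
Unset Strict Implicit.
Unset Printing Implicit Defensive.
Import Order.TTheory GRing.Theory Num.Theory.
Import numFieldNormedType.Exports.
Local Open Scope classical_set_scope.
Local Open Scope ring_scope.
Local Open Scope complex_scope.

(** * Smooth functions of two real variables *)

Section RealSmooth.
Variable R : realType.
Implicit Types (U : set (R * R)) (f g : R * R -> R) (v w : R * R).

(** The first-order expansion of [f] at [a] is also one of [g], so the differential of [f] serves
    for [g]. *)
Lemma near_eq_differentiable (V W : normedModType R) (f g : V -> W) (a : V) :
  {near a, f =1 g} -> differentiable f a -> differentiable g a.
Proof.
move=> fg df.
have cdf : continuous ('d f a) by exact: diff_continuous.
have gE : g \o shift a = cst (g a) + 'd f a +o_ (0 : V) id.
  apply/eqaddoP => e e0.
  have := diff_locally df => /eqaddoP /(_ e e0).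
  have fg0 : \forall h \near (0 : V), f (h + a) = g (h + a).
    by have := fg; rewrite (near_shift 0) /=; apply: filterS => h /=; rewrite subr0.
  move: fg0; apply: filterS2 => h /= fgh.
  by rewrite /= !fctE /= -fgh (nbhs_singleton fg).
by apply/diff_locallyP; rewrite (diff_unique cdf gE); split.
Qed.

Lemma open_near_eq U f g w : open U -> U w -> (forall u, U u -> f u = g u) ->
  {near w, f =1 g}.
Proof.
by move=> oU Uw fg; apply: filterS (open_nbhs_nbhs (conj oU Uw)) => u /fg.
Qed.

(** The rules of differentiation give a derivative only at points of [U]; openness of [U] lets
    regularity pass along such a restricted equality. *)
Lemma Ck_eq k U f g : open U -> (forall u, U u -> f u = g u) ->
  Ck k U f -> Ck k U g.
Proof.
move=> oU; elim: k f g => [|k IH] f g fg /=.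
  move=> cf w Uw; have nfg := open_near_eq oU Uw fg.
  rewrite /prop_for /continuous_at -(fg _ Uw).
  by apply: cvg_trans (cf w Uw); exact: near_eq_cvg.
case=> df Df; split=> [w Uw|v].
  exact: near_eq_differentiable (open_near_eq oU Uw fg) (df w Uw).
by apply: IH (Df v) => u Uu; apply: near_eq_derive; exact: open_near_eq fg.
Qed.

Lemma smooth_eq U f g : open U -> (forall u, U u -> f u = g u) ->
  smooth U f -> smooth U g.
Proof. by move=> oU fg sf k; exact: Ck_eq fg (sf k). Qed.

Lemma Ck_sub k U U' f : U `<=` U' -> Ck k U' f -> Ck k U f.
Proof.
move=> UU; elim: k f => [|k IH] f /=; first by move=> cf w /UU; exact: cf.
by case=> df Df; split=> [w /UU/df //|v]; apply: IH.
Qed.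

Lemma smooth_sub U U' f : U `<=` U' -> smooth U' f -> smooth U f.
Proof. by move=> UU sf k; exact: Ck_sub UU (sf k). Qed.

Lemma CkS k U f : Ck k.+1 U f -> Ck k U f.
Proof.
elim: k f => [|k IH] f /= [df Df].
  by move=> w /df; exact: differentiable_continuous.
by split=> // v; apply: IH; exact: Df.
Qed.

Lemma smooth_diff U f w : smooth U f -> U w -> differentiable f w.
Proof. by move=> /(_ 1%N) [df _]; exact: df. Qed.

Lemma smooth_derive U f v : smooth U f -> smooth U ('D_v f).
Proof. by move=> sf k; have [_] := sf k.+1; exact. Qed.

Lemma smooth_cst U (c : R) : smooth U (fun=> c).
Proof.
move=> k; have -> : (fun=> c) = cst c :> (R * R -> R) by [].
elim: k c => [|k IH] c /=; first by move=> w _; exact: cst_continuous.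
split=> [w _|v]; first exact: differentiable_cst.
suff -> : 'D_v (cst c) = cst 0 :> (R * R -> R) by exact: IH.
by apply/funext => w; rewrite derive_cst.
Qed.

Variable U : set (R * R).
Hypothesis oU : open U.

Lemma CkD k f g : Ck k U f -> Ck k U g -> Ck k U (f + g).
Proof.
elim: k f g => [|k IH] f g /=.
  by move=> cf cg w Uw; apply: cvgD; [exact: cf|exact: cg].
move=> [df Df] [dg Dg]; split=> [w Uw|v].
  by apply: differentiableD; [exact: df|exact: dg].
apply: (Ck_eq oU _ (IH _ _ (Df v) (Dg v))) => w Uw.
by rewrite deriveD //; apply: diff_derivable; [exact: df|exact: dg].
Qed.

Lemma CkN k f : Ck k U f -> Ck k U (- f).
Proof.
elim: k f => [|k IH] f /=.
  by move=> cf w Uw; apply: cvgN; exact: cf.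
move=> [df Df]; split=> [w Uw|v].
  by apply: differentiableN; exact: df.
apply: (Ck_eq oU _ (IH _ (Df v))) => w Uw.
by rewrite deriveN //; apply: diff_derivable; exact: df.
Qed.

(** The Leibniz rule keeps one factor undifferentiated, so the induction also uses [f] and [g] one
    order lower, through [CkS]. *)
Lemma CkM k f g : Ck k U f -> Ck k U g -> Ck k U (f * g).
Proof.
elim: k f g => [|k IH] f g.
  by move=> cf cg w Uw; apply: cvgM; [exact: cf|exact: cg].
move=> Cf Cg; have [df Df] := Cf; have [dg Dg] := Cg; split=> [w Uw|v].
  by apply: differentiableM; [exact: df|exact: dg].
apply: (@Ck_eq _ _ (f * 'D_v g + g * 'D_v f) _ oU).
  by move=> w Uw; rewrite deriveM //; apply: diff_derivable; [exact: df|exact: dg].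
by apply: CkD; [exact: IH (CkS Cf) (Dg v)|exact: IH (CkS Cg) (Df v)].
Qed.

Lemma smoothD f g : smooth U f -> smooth U g -> smooth U (fun w => f w + g w).
Proof. by move=> sf sg k; apply: CkD. Qed.

Lemma smoothN f : smooth U f -> smooth U (fun w => - f w).
Proof. by move=> sf k; apply: CkN. Qed.

Lemma smoothM f g : smooth U f -> smooth U g -> smooth U (fun w => f w * g w).
Proof. by move=> sf sg k; apply: CkM. Qed.

(** The derivative of [f^-1] is a polynomial in [f^-1] and the derivative of [f], so induction on
    the order closes on [f^-1] itself. *)
Lemma smoothV f : (forall w, U w -> f w != 0) -> smooth U f ->
  smooth U (fun w => (f w)^-1).
Proof.
move=> f0 sf; elim=> [|k IH].
  by move=> w Uw; apply: cvgV; [exact: f0|exact: (sf 0%N)].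
split=> [w Uw|v].
  by apply: differentiableV; [exact: smooth_diff sf Uw|exact: f0].
apply: (@Ck_eq _ _ (- ((fun w => (f w)^-1) * (fun w => (f w)^-1) * 'D_v f)) _ oU).
  move=> w Uw; rewrite deriveV ?f0//; last first.
    by apply: diff_derivable; exact: smooth_diff sf Uw.
  by rewrite !fctE /= -exprVn expr2 scaleNr.
by apply: CkN; apply: CkM (smooth_derive v sf k); exact: CkM.
Qed.

Lemma is_derive_sqrt_comp f v w : 0 < f w -> differentiable f w ->
  differentiable (fun u => Num.sqrt (f u)) w /\
  'D_v (fun u => Num.sqrt (f u)) w = (2 * Num.sqrt (f w))^-1 * 'D_v f w.
Proof.
move=> f0 df.
have [ds Ds] := is_derive1_sqrt f0.
have dsq : differentiable (Num.sqrt : R -> R) (f w) by exact/derivable1_diffP.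
have dc : differentiable (Num.sqrt \o f) w by exact: differentiable_comp.
split=> //; rewrite (deriveE v dc) (diff_comp df dsq) /= diff1E // -deriveE //.
by rewrite derive1E Ds; exact: mulrC.
Qed.

Lemma smooth_sqrt f : (forall w, U w -> 0 < f w) -> smooth U f ->
  smooth U (fun w => Num.sqrt (f w)).
Proof.
move=> f0 sf; elim=> [|k IH].
  move=> w Uw; apply: differentiable_continuous.
  by have [] := is_derive_sqrt_comp 0 (f0 w Uw) (smooth_diff sf Uw).
split=> [w Uw|v].
  by have [] := is_derive_sqrt_comp 0 (f0 w Uw) (smooth_diff sf Uw).
(* Rewriting [q] as [2^-1 * sqrt f * f^-1] lets the induction hypothesis on [sqrt f] apply, with
   only [f] inverted. *)
pose q u := (2 * Num.sqrt (f u))^-1.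
have Cq : Ck k U q.
  suff : Ck k U ((fun w => 2^-1 * Num.sqrt (f w)) * (fun w => (f w)^-1)).
    apply: Ck_eq => // u Uu; rewrite /q !fctE.
    have s0 : Num.sqrt (f u) != 0 by rewrite gt_eqF // sqrtr_gt0 f0.
    rewrite -{2}(sqr_sqrtr (ltW (f0 u Uu))); field; exact: s0.
  apply: CkM; first by apply: CkM IH; exact: smooth_cst.
  by apply: smoothV => // w Uw; rewrite gt_eqF ?f0.
apply: (@Ck_eq _ _ (q * 'D_v f) _ oU); last by apply: CkM Cq _; exact: smooth_derive.
by move=> w Uw; have [_ ->] := is_derive_sqrt_comp v (f0 w Uw) (smooth_diff sf Uw).
Qed.

End RealSmooth.

(** * Symmetry of second derivatives *)

Section Clairaut.
Variable R : realType.
Implicit Types (f : R * R -> R) (u v w : R * R).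

Lemma is_derive_line f w u (s : R) : differentiable f (w + s *: u) ->
  is_derive s 1 (fun t : R => f (w + t *: u)) ('D_u f (w + s *: u)).
Proof.
move=> df.
have E : (fun h : R => h^-1 *: (((fun t : R => f (w + t *: u)) \o shift s) (h *: 1)
            - f (w + s *: u)))
       = (fun h => h^-1 *: ((f \o shift (w + s *: u)) (h *: u) - f (w + s *: u))).
  apply/funext => h /=; congr (_ *: (f _ - _)).
  by rewrite [h%:A]mulr1 scalerDl addrCA.
by split; rewrite /derivable /derive E //; exact: diff_derivable.
Qed.

(** The mean value theorem is applied twice: along [u] to the difference of [f] across [h *: v],
    then along [v] to ['D_u f]. *)
Lemma double_MVT f w u v (h : R) : 0 < h ->
  (forall s t, 0 <= s <= h -> 0 <= t <= h ->
     differentiable f (w + s *: u + t *: v) /\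
     differentiable ('D_u f) (w + s *: u + t *: v)) ->
  exists s t : R, [/\ 0 < s < h, 0 < t < h &
    f (w + h *: u + h *: v) - f (w + h *: u) - f (w + h *: v) + f w =
    'D_v ('D_u f) (w + s *: u + t *: v) * h * h].
Proof.
move=> h0 df.
have h00 : 0 <= h <= h by rewrite ltW /=.
have z0 : 0 <= (0 : R) <= h by rewrite lexx /= ltW.
pose phi (s : R) := f (w + h *: v + s *: u) - f (w + s *: u).
pose dphi (s : R) := 'D_u f (w + h *: v + s *: u) - 'D_u f (w + s *: u).
have dphiP s : 0 <= s <= h -> is_derive s 1 phi (dphi s).
  move=> sh; apply: is_deriveB; apply: is_derive_line.
    by rewrite addrAC; have [] := df _ _ sh h00.
  by have [] := df _ _ sh z0; rewrite scale0r addr0.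
have [s] : exists2 s, s \in `]0, h[%R & phi h - phi 0 = dphi s * (h - 0).
  apply: (MVT h0) => [s|].
    by rewrite in_itv /= => /andP[s0 sh]; apply: dphiP; rewrite !ltW.
  apply: derivable_within_continuous => s; rewrite in_itv /= => sh.
  by have [] := dphiP s sh.
rewrite in_itv /= subr0 => /andP[s0 sh] Es.
have sh' : 0 <= s <= h by rewrite !ltW.
have dpsiP t : 0 <= t <= h -> is_derive t 1 (fun t => 'D_u f (w + s *: u + t *: v))
    ('D_v ('D_u f) (w + s *: u + t *: v)).
  by move=> th; apply: is_derive_line; have [] := df _ _ sh' th.
have [t] : exists2 t, t \in `]0, h[%R & 'D_u f (w + s *: u + h *: v) -
    'D_u f (w + s *: u + 0 *: v) = 'D_v ('D_u f) (w + s *: u + t *: v) * (h - 0).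
  apply: (@MVT R (fun t => 'D_u f (w + s *: u + t *: v))
      (fun t => 'D_v ('D_u f) (w + s *: u + t *: v)) 0 h h0) => [t|].
    by rewrite in_itv /= => /andP[t0 th]; apply: dpsiP; rewrite !ltW.
  apply: derivable_within_continuous => t; rewrite in_itv /= => th.
  by have [] := dpsiP t th.
rewrite in_itv /= subr0 => th Et.
exists s, t; split=> //; first by rewrite s0.
rewrite -Et scale0r addr0; move: Es; rewrite /phi /dphi scale0r !addr0.
by rewrite !(addrAC w (h *: v)) => <-; ring.
Qed.

(** Continuity at the origin of the map sending (s, t) to [w + s *: u + t *: v] gives one bound
    valid for both parameters. *)
Lemma near_parallelogram (P : set (R * R)) w u v : (\forall z \near w, P z) ->
  exists2 e : R, 0 < e & forall s t : R, `|s| < e -> `|t| < e ->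
    P (w + s *: u + t *: v).
Proof.
move=> Pw; pose T (p : R * R) := w + p.1 *: u + p.2 *: v.
have cT : {for (0, 0), continuous T}.
  rewrite /prop_for /continuous_at; apply: cvgD; first apply: cvgD.
  - exact: cvg_cst.
  - by apply: cvgZr_tmp; exact: cvg_fst.
  - by apply: cvgZr_tmp; exact: cvg_snd.
have : nbhs ((0, 0) : R * R) (T @^-1` P).
  by apply: cT; rewrite /T /= !scale0r !addr0.
move=> /nbhs_ballP[e /= e0 eP]; exists e => // s t se te.
by apply: (eP (s, t)); split; rewrite /= /ball /= sub0r normrN.
Qed.

Lemma dist_le_halves (a b c e : R) :
  `|a - c| < e / 2 -> `|b - c| < e / 2 -> `|a - b| <= e.
Proof.
move=> ac bc; rewrite (le_trans (ler_distD c a b)) // (splitr e) lerD // ltW //.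
by rewrite distrC.
Qed.

(** The second difference over a small parallelogram is symmetric in [u] and [v]. Each order of the
    mean value theorem expresses it by one of the mixed derivatives at a nearby point, and
    continuity of both derivatives concludes. *)
Lemma derive_commute (U : set (R * R)) f w u v : open U -> smooth U f -> U w ->
  'D_v ('D_u f) w = 'D_u ('D_v f) w.
Proof.
move=> oU sf Uw.
have key e : 0 < e -> `|'D_v ('D_u f) w - 'D_u ('D_v f) w| <= e.
  move=> e0; have e20 : 0 < e / 2 by rewrite divr_gt0.
  have nU : \forall z \near w, U z by exact: open_nbhs_nbhs.
  have near2 a b : \forall z \near w, `|'D_b ('D_a f) w - 'D_b ('D_a f) z| < e / 2.
    have /smooth_derive/(_ 0%N) /(_ w Uw) := smooth_derive a sf.
    by move=> /(_ b)/cvgrPdist_lt /(_ _ e20).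
  have [d d0 dP] := near_parallelogram u v
    (filterI nU (filterI (near2 u v) (near2 v u))).
  have [h [h0 hd]] : exists h, 0 < h /\ h < d by exists (d / 2); lra.
  have nh s : 0 <= s <= h -> `|s| < d.
    by move=> /andP[s0 sh]; rewrite ger0_norm // (le_lt_trans sh).
  have [s [t [st th E1]]] := @double_MVT f w u v h h0 (fun s t sh th =>
    let: conj Uz _ := dP s t (nh _ sh) (nh _ th) in
    conj (smooth_diff sf Uz) (smooth_diff (smooth_derive _ sf) Uz)).
  have swap (a b : R) : w + a *: v + b *: u = w + b *: u + a *: v by rewrite addrAC.
  have [s' [t' [st' th' E2]]] : exists s t : R, [/\ 0 < s < h, 0 < t < h &
    f (w + h *: v + h *: u) - f (w + h *: v) - f (w + h *: u) + f w =
    'D_u ('D_v f) (w + s *: v + t *: u) * h * h].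
    apply: double_MVT => // a b ah bh; rewrite swap.
    have [Uz _] := dP b a (nh _ bh) (nh _ ah).
    by split; [exact: smooth_diff sf Uz|exact: smooth_diff (smooth_derive _ sf) Uz].
  have wk (a : R) : 0 < a < h -> 0 <= a <= h by move=> /andP[? ?]; rewrite !ltW.
  have [_ [n1 _]] := dP _ _ (nh _ (wk _ st)) (nh _ (wk _ th)).
  have [_ [_ n2]] := dP _ _ (nh _ (wk _ th')) (nh _ (wk _ st')).
  rewrite -swap in n2.
  (* Both values are the same second difference divided by [h * h]. *)
  have EE : 'D_v ('D_u f) (w + s *: u + t *: v) =
            'D_u ('D_v f) (w + s' *: v + t' *: u).
    have hn0 : h != 0 by rewrite gt_eqF.
    rewrite (swap h h) (addrAC _ (- f (w + h *: v))) E1 in E2.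
    by apply: (mulIf hn0); apply: (mulIf hn0).
  rewrite -EE in n2.
  exact: dist_le_halves n1 n2.
apply/eqP; rewrite -subr_eq0 -normr_le0; apply/ler_addgt0Pl => e e0.
by rewrite addr0; exact: key.
Qed.

End Clairaut.

(** * Wirtinger calculus *)

Section ComplexCalculus.
Variable R : realType.
Implicit Types (f g : R * R -> R[i]) (v w : R * R) (t : R[i]).

Definition cdiff f w :=
  differentiable (fun u => complex.Re (f u)) w /\
  differentiable (fun u => complex.Im (f u)) w.

Lemma complexP (x y : R[i]) :
  complex.Re x = complex.Re y -> complex.Im x = complex.Im y -> x = y.
Proof. by case: x y => [a b] [c d] /= -> ->. Qed.

Lemma ReM (x y : R[i]) : complex.Re (x * y) =
  complex.Re x * complex.Re y - complex.Im x * complex.Im y.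
Proof. by case: x y => [a b] [c d]. Qed.

Lemma ImM (x y : R[i]) : complex.Im (x * y) =
  complex.Re x * complex.Im y + complex.Im x * complex.Re y.
Proof. by case: x y => [a b] [c d]. Qed.

Lemma ReD (x y : R[i]) : complex.Re (x + y) = complex.Re x + complex.Re y.
Proof. by case: x y => [a b] [c d]. Qed.

Lemma ImD (x y : R[i]) : complex.Im (x + y) = complex.Im x + complex.Im y.
Proof. by case: x y => [a b] [c d]. Qed.

Lemma ReN (x : R[i]) : complex.Re (- x) = - complex.Re x.
Proof. by case: x. Qed.

Lemma ImN (x : R[i]) : complex.Im (- x) = - complex.Im x.
Proof. by case: x. Qed.

Lemma ReJ (x : R[i]) : complex.Re (x^*%C) = complex.Re x.
Proof. by case: x. Qed.

Lemma ImJ (x : R[i]) : complex.Im (x^*%C) = - complex.Im x.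
Proof. by case: x. Qed.

Lemma conjcM (x y : R[i]) : (x * y)^*%C = x^*%C * y^*%C.
Proof. exact: rmorphM. Qed.

Lemma conjcD (x y : R[i]) : (x + y)^*%C = x^*%C + y^*%C.
Proof. exact: rmorphD. Qed.

Lemma conjcN (x : R[i]) : (- x)^*%C = - x^*%C.
Proof. exact: rmorphN. Qed.

Lemma cdiff_cst (c : R[i]) w : cdiff (fun=> c) w.
Proof. by split; exact: differentiable_cst. Qed.

Lemma cdiffD f g w : cdiff f w -> cdiff g w -> cdiff (fun u => f u + g u) w.
Proof.
move=> [f1 f2] [g1 g2]; split.
  rewrite (_ : (fun u => _) = (fun u => complex.Re (f u)) + (fun u => complex.Re (g
    u))).
    exact: differentiableD.
  by apply/funext => u; rewrite ReD.
rewrite (_ : (fun u => _) = (fun u => complex.Im (f u)) + (fun u => complex.Im (g u))).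
  exact: differentiableD.
by apply/funext => u; rewrite ImD.
Qed.

Lemma cderiveD v f g w : cdiff f w -> cdiff g w ->
  cderive v (fun u => f u + g u) w = cderive v f w + cderive v g w.
Proof.
move=> [f1 f2] [g1 g2]; rewrite /cderive.
rewrite (_ : (fun u => complex.Re (_ + _)) =
  (fun u => complex.Re (f u)) + (fun u => complex.Re (g u))); last first.
  by apply/funext => u; rewrite ReD.
rewrite (_ : (fun u => complex.Im (_ + _)) =
  (fun u => complex.Im (f u)) + (fun u => complex.Im (g u))); last first.
  by apply/funext => u; rewrite ImD.
by rewrite !deriveD //; exact: diff_derivable.
Qed.

Lemma cdiffM f g w : cdiff f w -> cdiff g w -> cdiff (fun u => f u * g u) w.
Proof.
move=> [f1 f2] [g1 g2]; split.
  rewrite (_ : (fun u => _) =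
      (fun u => complex.Re (f u)) * (fun u => complex.Re (g u))
    - (fun u => complex.Im (f u)) * (fun u => complex.Im (g u))).
    by apply: differentiableB; exact: differentiableM.
  by apply/funext => u; rewrite ReM.
rewrite (_ : (fun u => _) =
    (fun u => complex.Re (f u)) * (fun u => complex.Im (g u))
  + (fun u => complex.Im (f u)) * (fun u => complex.Re (g u))).
  by apply: differentiableD; exact: differentiableM.
by apply/funext => u; rewrite ImM.
Qed.

Lemma cderiveM v f g w : cdiff f w -> cdiff g w ->
  cderive v (fun u => f u * g u) w = cderive v f w * g w + f w * cderive v g w.
Proof.
move=> [f1 f2] [g1 g2]; rewrite /cderive.
rewrite (_ : (fun u => complex.Re (_ * _)) =
      (fun u => complex.Re (f u)) * (fun u => complex.Re (g u))
    - (fun u => complex.Im (f u)) * (fun u => complex.Im (g u))); last first.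
  by apply/funext => u; rewrite ReM.
rewrite (_ : (fun u => complex.Im (_ * _)) =
    (fun u => complex.Re (f u)) * (fun u => complex.Im (g u))
  + (fun u => complex.Im (f u)) * (fun u => complex.Re (g u))); last first.
  by apply/funext => u; rewrite ImM.
rewrite deriveB; [|by apply: diff_derivable; apply: differentiableM..].
rewrite deriveD; [|by apply: diff_derivable; apply: differentiableM..].
rewrite !deriveM; [|by apply: diff_derivable..].
move: ('D_v _ w) ('D_v _ w) ('D_v _ w) ('D_v _ w) => a b c d.
apply: complexP; rewrite ?ReD ?ImD ?ReM ?ImM /GRing.scale /=; ring.
Qed.

Lemma cderive_cst v (c : R[i]) w : cderive v (fun=> c) w = 0.
Proof.
rewrite /cderive; move: (complex.Re c) (complex.Im c) => a b.
by rewrite -[fun=> a]/(cst a) -[fun=> b]/(cst b) !derive_cst.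
Qed.

Lemma cderiveJ v f w : cdiff f w ->
  cderive v (fun u => (f u)^*%C) w = (cderive v f w)^*%C.
Proof.
move=> [f1 f2]; rewrite /cderive.
rewrite (_ : (fun u => complex.Re _) = (fun u => complex.Re (f u))); last first.
  by apply/funext => u; rewrite ReJ.
rewrite (_ : (fun u => complex.Im _) = - (fun u => complex.Im (f u))); last first.
  by apply/funext => u; rewrite ImJ.
by rewrite deriveN //; exact: diff_derivable.
Qed.

(* The two Wirtinger derivatives are [dz = wd (- 'i)] and [dzb = wd 'i]. *)
Definition wd t f w : R[i] :=
  2^-1 * (cderive (1, 0) f w + t * cderive (0, 1) f w).

Lemma dzE f w : dz f w = wd (- 'i%C) f w.
Proof. by rewrite /dz /wd mulNr. Qed.

Lemma dzbE f w : dzb f w = wd 'i%C f w.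
Proof. by []. Qed.

Lemma wd_cst t (c : R[i]) w : wd t (fun=> c) w = 0.
Proof. by rewrite /wd !cderive_cst mulr0 addr0 mulr0. Qed.

Lemma wdD t f g w : cdiff f w -> cdiff g w ->
  wd t (fun u => f u + g u) w = wd t f w + wd t g w.
Proof.
move=> cf cg; rewrite /wd !cderiveD //.
move: (cderive _ _ _) (cderive _ _ _) (cderive _ _ _) (cderive _ _ _) => a b c d.
ring.
Qed.

Lemma wdM t f g w : cdiff f w -> cdiff g w ->
  wd t (fun u => f u * g u) w = wd t f w * g w + f w * wd t g w.
Proof.
move=> cf cg; rewrite /wd !cderiveM //.
move: (f w) (g w) (cderive _ _ _) (cderive _ _ _) (cderive _ _ _) (cderive _ _ _).
move=> x y a b c d; ring.
Qed.

Lemma wdJ t f w : cdiff f w ->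
  wd t (fun u => (f u)^*%C) w = (wd (t^*%C) f w)^*%C.
Proof.
move=> cf; rewrite /wd !cderiveJ //.
by rewrite !conjcM conjcD conjcM conjcK conjc_inv conjc_nat.
Qed.

Lemma near_eq_cderive v f g w : {near w, f =1 g} -> cderive v f w = cderive v g w.
Proof.
move=> fg; rewrite /cderive; congr (_ +i* _); apply: near_eq_derive;
  by apply: filterS fg => u ->.
Qed.

Lemma near_eq_wd t f g w : {near w, f =1 g} -> wd t f w = wd t g w.
Proof. by move=> fg; rewrite /wd !(near_eq_cderive _ fg). Qed.

(* The derivative of the inverse is read off the derivative of [f * f^-1 = 1]. *)
Lemma wdV t f w : cdiff f w -> cdiff (fun u => (f u)^-1) w ->
  (\near w, f w != 0) -> wd t (fun u => (f u)^-1) w = - wd t f w / f w ^+ 2.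
Proof.
move=> cf cV f0.
have f0w : f w != 0 by exact: nbhs_singleton f0.
have : wd t (fun u => f u * (f u)^-1) w = 0.
  rewrite (@near_eq_wd _ _ (fun=> 1)) ?wd_cst //.
  by apply: filterS f0 => u fu; rewrite divff.
rewrite wdM //; move: (wd t f w) (wd t _ w) => a b.
move/eqP; rewrite addrC addr_eq0 => /eqP E.
apply: (mulfI f0w); rewrite E; field; exact: f0w.
Qed.

Section Smooth.
Variable U : set (R * R).
Hypothesis oU : open U.

Lemma csmooth_diff f w : csmooth U f -> U w -> cdiff f w.
Proof. by move=> [f1 f2] Uw; split; [exact: smooth_diff f1 Uw|exact: smooth_diff f2
  Uw]. Qed.

Lemma csmooth_eq f g : (forall u, U u -> f u = g u) -> csmooth U f -> csmooth U g.
Proof.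
by move=> fg [f1 f2]; split; [move: f1|move: f2]; apply: smooth_eq => // u Uu; rewrite
  fg.
Qed.

Lemma csmooth_sub U' f : U `<=` U' -> csmooth U' f -> csmooth U f.
Proof.
by move=> UU [f1 f2]; split; [exact: smooth_sub UU f1|exact: smooth_sub UU f2].
Qed.

Lemma csmooth_cst (c : R[i]) : csmooth U (fun=> c).
Proof. by split; exact: smooth_cst. Qed.

Lemma csmoothD f g : csmooth U f -> csmooth U g -> csmooth U (fun u => f u + g u).
Proof.
move=> [f1 f2] [g1 g2]; split.
  by apply: smooth_eq oU _ (smoothD oU f1 g1) => u _; rewrite ReD.
by apply: smooth_eq oU _ (smoothD oU f2 g2) => u _; rewrite ImD.
Qed.

Lemma csmoothM f g : csmooth U f -> csmooth U g -> csmooth U (fun u => f u * g u).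
Proof.
move=> [f1 f2] [g1 g2]; split.
  apply: smooth_eq oU _ (smoothD oU (smoothM oU f1 g1)
    (smoothN oU (smoothM oU f2 g2))) => u _.
  by rewrite ReM.
apply: smooth_eq oU _ (smoothD oU (smoothM oU f1 g2) (smoothM oU f2 g1)) => u _.
by rewrite ImM.
Qed.

Lemma csmoothJ f : csmooth U f -> csmooth U (fun u => (f u)^*%C).
Proof.
move=> [f1 f2]; split.
  by apply: smooth_eq oU _ f1 => u _; rewrite ReJ.
by apply: smooth_eq oU _ (smoothN oU f2) => u _; rewrite ImJ.
Qed.

Lemma csmooth_real (f : R * R -> R) : smooth U f -> csmooth U (fun u => (f u)%:C).
Proof. by move=> sf; split=> //; exact: smooth_cst. Qed.

(** Writing [f^-1] as the conjugate of [f] over [n = |f|^2] reduces the claim to the inverse of a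
    real function. *)
Lemma csmoothV f : (forall w, U w -> f w != 0) -> csmooth U f ->
  csmooth U (fun u => (f u)^-1).
Proof.
move=> f0 sf; have [f1 f2] := sf.
pose n u := complex.Re (f u) * complex.Re (f u) + complex.Im (f u) * complex.Im (f u).
have nE u : (n u)%:C = f u * (f u)^*%C.
  by rewrite /n; case: (f u) => a b; apply: complexP; rewrite /=; ring.
have sn : smooth U n by apply: (smoothD oU); exact: (smoothM oU).
have n0 u : U u -> n u != 0.
  move=> Uu; rewrite -(inj_eq (@complexI R)) nE mulf_neq0 ?f0 //.
  by rewrite conjc_eq0 f0.
apply: csmooth_eq (csmoothM (csmoothJ sf) (csmooth_real (smoothV oU n0 sn))) => u Uu.
rewrite fmorphV /= nE; have := f0 u Uu; rewrite -(conjc_eq0 (f u)) => fc0.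
field; by rewrite fc0 f0.
Qed.

Lemma csmooth_cderive v f : csmooth U f -> csmooth U (cderive v f).
Proof. by move=> [f1 f2]; split; exact: smooth_derive. Qed.

Lemma csmooth_wd t f : csmooth U f -> csmooth U (wd t f).
Proof.
move=> sf; apply: csmoothM; first exact: csmooth_cst.
apply: csmoothD; first exact: csmooth_cderive.
by apply: csmoothM; [exact: csmooth_cst|exact: csmooth_cderive].
Qed.

Lemma cderive_commute u v f w : csmooth U f -> U w ->
  cderive v (cderive u f) w = cderive u (cderive v f) w.
Proof.
move=> [f1 f2] Uw; rewrite /cderive /=.
by rewrite (derive_commute u v oU f1 Uw) (derive_commute u v oU f2 Uw).
Qed.

(** Expanded into second real derivatives, both sides are symmetric in [s] and [t] once the two
    mixed derivatives are identified. *)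
Lemma wd_commute s t f w : csmooth U f -> U w ->
  wd s (wd t f) w = wd t (wd s f) w.
Proof.
move=> sf Uw.
have key a b : wd a (wd b f) w = 2^-1 * (2^-1 *
    (cderive (1, 0) (cderive (1, 0) f) w + b * cderive (1, 0) (cderive (0, 1) f) w)
    + a * (2^-1 * (cderive (0, 1) (cderive (1, 0) f) w
                   + b * cderive (0, 1) (cderive (0, 1) f) w))).
  have cd v : cdiff (cderive v f) w.
    by apply: csmooth_diff Uw; exact: csmooth_cderive.
  have cc (c : R[i]) : cdiff (fun=> c) w by exact: cdiff_cst.
  have E v : cderive v (wd b f) w = 2^-1 * (cderive v (cderive (1, 0) f) w
      + b * cderive v (cderive (0, 1) f) w).
    rewrite [wd b f](_ : _ = (fun u => 2^-1 * (cderive (1, 0) f u + b * cderive (0, 1)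
      f u))) //.
    rewrite cderiveM ?cderive_cst ?mul0r ?add0r //; last first.
      by apply: cdiffD => //; apply: cdiffM.
    rewrite cderiveD //; last by apply: cdiffM.
    by rewrite cderiveM ?cderive_cst ?mul0r ?add0r.
  by rewrite {1}/wd !E.
rewrite !key (cderive_commute (1, 0) (0, 1) sf Uw).
move: (cderive _ _ _) (cderive _ _ _) (cderive _ _ _) => a b c; ring.
Qed.

End Smooth.
End ComplexCalculus.

(** * Holomorphic change of coordinate *)

Section ChainRule.
Variable R : realType.
Implicit Types (T : R * R -> R * R) (w : R * R).

(** The differential of [f] is determined by its two partial derivatives, and linearity of [fst] and
    [snd] makes the coordinates of ['d T w v] the derivatives of the coordinates of [T]. *)
Lemma derive_comp_plane (f : R * R -> R) T v w :
  differentiable T w -> differentiable f (T w) ->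
  'D_v (fun u => f (T u)) w =
    'D_v (fun u => (T u).1) w * 'D_(1, 0) f (T w)
    + 'D_v (fun u => (T u).2) w * 'D_(0, 1) f (T w).
Proof.
move=> dT df.
have cfst : continuous (fst : R * R -> R) by move=> z; exact: cvg_fst.
have csnd : continuous (snd : R * R -> R) by move=> z; exact: cvg_snd.
have dfst : differentiable (fst : R * R -> R) (T w) by exact: linear_differentiable.
have dsnd : differentiable (snd : R * R -> R) (T w) by exact: linear_differentiable.
have compE (g : R * R -> R) : differentiable g (T w) ->
    'D_v (g \o T) w = 'd g (T w) ('d T w v).
  move=> dg; have dc : differentiable (g \o T) w by apply: differentiable_comp.
  by rewrite (deriveE v dc); exact: (congr1 (fun h => h v) (diff_comp dT dg)).
have lin z : 'd f (T w) z = z.1 * 'D_(1, 0) f (T w) + z.2 * 'D_(0, 1) f (T w).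
  rewrite (deriveE _ df) (deriveE _ df); case: z => p q /=.
  rewrite -[p * _]linearZ -[q * _]linearZ -linearD; congr ('d f (T w) _).
  change ((p, q) = (p * 1 + q * 0, p * 0 + q * 1)).
  by rewrite !mulr1 !mulr0 addr0 add0r.
transitivity ('d f (T w) ('d T w v)); first exact: compE.
rewrite lin; congr (_ * _ + _ * _); apply: esym.
  apply: (etrans (compE _ dfst)).
  exact: (congr1 (fun h => h ('d T w v)) (diff_lin (T w) cfst)).
apply: (etrans (compE _ dsnd)).
exact: (congr1 (fun h => h ('d T w v)) (diff_lin (T w) csnd)).
Qed.

Lemma complex_lin_comb (a b c d e g : R) : (a * c + b * e) +i* (a * d + b * g) =
  a%:C * (c +i* d) + b%:C * (e +i* g).
Proof. by apply: complexP; rewrite ?ReD ?ImD ?ReM ?ImM /=; ring. Qed.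

(** The factor [tau] is dT/dz. The Cauchy-Riemann equations remove the terms that would mix d/dz
    with d/dzbar, so a single [tau] serves every [f]. *)
Lemma wirtinger_chain T w : differentiable T w ->
  dzb (fun u => (T u).1 +i* (T u).2) w = 0 ->
  exists tau : R[i], forall f, cdiff f (T w) ->
    [/\ cdiff (fun u => f (T u)) w,
        dz (fun u => f (T u)) w = tau * dz f (T w) &
        dzb (fun u => f (T u)) w = tau^*%C * dzb f (T w)].
Proof.
move=> dT CR; rewrite /dzb /cderive /= in CR.
pose p1 : R := 'D_(1, 0) (fun u => (T u).1) w; pose p2 : R := 'D_(1, 0) (fun u => (T
  u).2) w.
have {CR} [E1 E2] : 'D_(0, 1) (fun u => (T u).1) w = - p2 /\
                  'D_(0, 1) (fun u => (T u).2) w = p1.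
  move: CR; rewrite -/p1 -/p2.
  move: p1 p2 ('D_(0, 1) (fun u => (T u).1) w) ('D_(0, 1) (fun u => (T u).2) w).
  move=> a b c d /eqP; rewrite mulf_eq0 invr_eq0 pnatr_eq0 /= => /eqP.
  by case => H1 H2; split; lra.
exists (p1 +i* p2) => f [f1 f2].
have cE v : cderive v (fun u => f (T u)) w =
  ('D_v (fun u => (T u).1) w)%:C * cderive (1, 0) f (T w)
  + ('D_v (fun u => (T u).2) w)%:C * cderive (0, 1) f (T w).
  rewrite /cderive; rewrite (derive_comp_plane v dT f1) (derive_comp_plane v dT f2).
  exact: complex_lin_comb.
split.
- split; first exact: (@differentiable_comp _ _ _ _ T (fun z => complex.Re (f z)) w dT
  f1).
  exact: (@differentiable_comp _ _ _ _ T (fun z => complex.Im (f z)) w dT f2).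
- rewrite /dz !cE E1 E2 -/p1 -/p2.
  move: p1 p2 (cderive _ _ _) (cderive _ _ _) {E1 E2 cE} => p q a b.
  have -> : p +i* q = p%:C + 'i%C * q%:C by rewrite [LHS]complexE.
  rewrite rmorphN /=; have := sqr_i R; move: ('i%C : R[i]) (p%:C) (q%:C) => i x y i2.
  have : (i * i + 1) * (a * y) = 0 by rewrite -expr2 i2 addNr mul0r.
  move=> H; apply/eqP; rewrite -subr_eq0; apply/eqP.
  (* With [i] an abstract root of -1, the two sides differ by a multiple of [i * i + 1]. *)
  transitivity (2^-1 * ((i * i + 1) * (a * y))); last by rewrite H mulr0.
  ring.
- rewrite /dzb !cE E1 E2 -/p1 -/p2.
  move: p1 p2 (cderive _ _ _) (cderive _ _ _) {E1 E2 cE} => p q a b.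
  have -> : (p +i* q)^*%C = p%:C - 'i%C * q%:C.
    by apply: complexP; rewrite ?ReJ ?ImJ ?ReD ?ImD ?ReN ?ImN ?ReM ?ImM /=; ring.
  rewrite rmorphN /=; have := sqr_i R; move: ('i%C : R[i]) (p%:C) (q%:C) => i x y i2.
  have : (i * i + 1) * (a * y) = 0 by rewrite -expr2 i2 addNr mul0r.
  move=> H; apply/eqP; rewrite -subr_eq0; apply/eqP.
  transitivity (2^-1 * ((i * i + 1) * (a * y))); last by rewrite H mulr0.
  ring.
Qed.

End ChainRule.

(** * Vector-valued functions and bilinear forms *)

Section BilinearForms.
Variable R : realType.
Local Notation C := R[i].

Section Dot.
Variable m : nat.
Implicit Types (u v z : 'rV[C]_m) (a : C).

Lemma dotE u v : dot u v = \sum_j u 0 j * v 0 j.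
Proof. by rewrite /dot mxE; apply: eq_bigr => j _; rewrite mxE. Qed.

Lemma dotC u v : dot u v = dot v u.
Proof. by rewrite !dotE; apply: eq_bigr => j _; rewrite mulrC. Qed.

Lemma dotDl u v z : dot (u + v) z = dot u z + dot v z.
Proof. by rewrite /dot mulmxDl mxE. Qed.

Lemma dotZl a u v : dot (a *: u) v = a * dot u v.
Proof. by rewrite /dot -scalemxAl mxE. Qed.

Lemma dotDr u v z : dot z (u + v) = dot z u + dot z v.
Proof. by rewrite !(dotC z) dotDl. Qed.

Lemma dotZr a u v : dot v (a *: u) = a * dot v u.
Proof. by rewrite !(dotC v) dotZl. Qed.

Lemma dot0l u : dot 0 u = 0.
Proof. by rewrite /dot mul0mx mxE. Qed.

Lemma dot0r u : dot u 0 = 0.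
Proof. by rewrite dotC dot0l. Qed.

End Dot.

Definition vconj m (u : 'rV[C]_m) : 'rV[C]_m := map_mx (@conjc R) u.

Lemma vconjD m (u v : 'rV[C]_m) : vconj (u + v) = vconj u + vconj v.
Proof. exact: map_mxD. Qed.

Lemma vconjN m (u : 'rV[C]_m) : vconj (- u) = - vconj u.
Proof. exact: map_mxN. Qed.

Lemma vconjZ m a (u : 'rV[C]_m) : vconj (a *: u) = a^*%C *: vconj u.
Proof. exact: map_mxZ. Qed.

Lemma vconjK m : involutive (@vconj m).
Proof. by move=> u; apply/rowP => j; rewrite !mxE conjcK. Qed.

Lemma vconj_cplx m (u : 'rV[R]_m) : vconj (cplx u) = cplx u.
Proof. by apply/rowP => j; rewrite !mxE conjc_real. Qed.

Lemma cplx_Re m (u : 'rV[C]_m) : vconj u = u -> cplx (map_mx (@complex.Re R) u) = u.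
Proof.
move=> uR; apply/rowP => j; have := congr1 (fun v : 'rV_m => v 0 j) uR.
rewrite !mxE; case: (u 0 j) => a b [] /= bN; apply: complexP => //=; lra.
Qed.

Lemma conjc_dot m (u v : 'rV[C]_m) : (dot u v)^*%C = dot (vconj u) (vconj v).
Proof.
rewrite !dotE rmorph_sum /=; apply: eq_bigr => j _.
by rewrite !mxE conjcM.
Qed.

Lemma cplx_dot m (u v : 'rV[R]_m) : dot (cplx u) (cplx v) = ((u *m v^T) 0 0)%:C.
Proof. by rewrite /dot /cplx map_trmx -map_mxM mxE. Qed.

Section Lorentz.
Variable m : nat.
Implicit Types (u v z : 'rV[C]_(m + 1)) (a : C).

Lemma lorentz_gramT (K : fieldType) : (lorentz_gram K m)^T = lorentz_gram K m.
Proof. by rewrite /lorentz_gram tr_block_mx !trmx0 trmx1 tr_scalar_mx. Qed.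

Lemma lorentzC u v : lorentz u v = lorentz v u.
Proof.
by rewrite /lorentz -[in LHS](trmxK (_ *m _ *m _)) mxE !trmx_mul trmxK
  lorentz_gramT mulmxA.
Qed.

Lemma lorentzDl u v z : lorentz (u + v) z = lorentz u z + lorentz v z.
Proof. by rewrite /lorentz !mulmxDl mxE. Qed.

Lemma lorentzZl a u v : lorentz (a *: u) v = a * lorentz u v.
Proof. by rewrite /lorentz -!scalemxAl mxE. Qed.

Lemma lorentzDr u v z : lorentz z (u + v) = lorentz z u + lorentz z v.
Proof. by rewrite !(lorentzC z) lorentzDl. Qed.

Lemma lorentzZr a u v : lorentz v (a *: u) = a * lorentz v u.
Proof. by rewrite !(lorentzC v) lorentzZl. Qed.

Lemma lorentz_row_mx (u v : 'rV[C]_m) (a b : C) :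
  lorentz (row_mx u a%:M) (row_mx v b%:M) = dot u v - a * b.
Proof.
rewrite /lorentz /lorentz_gram mul_row_block !mulmx0 addr0 add0r mulmx1.
rewrite tr_row_mx mul_row_col mxE tr_scalar_mx -!scalar_mxM [X in _ + X]mxE eqxx.
rewrite mulr1n.
by rewrite mulrN1 mulNr.
Qed.

Lemma dot_row_mx (u v : 'rV[C]_m) (a b : C) :
  dot (row_mx u a%:M) (row_mx v b%:M) = dot u v + a * b.
Proof.
rewrite /dot tr_row_mx mul_row_col mxE tr_scalar_mx -!scalar_mxM.
by rewrite [X in _ + X]mxE eqxx mulr1n.
Qed.

End Lorentz.

(** Splits the Lorentz space into the Euclidean part, one further spacelike coordinate [a] and the
    timelike coordinate [b]. *)
Definition mrow (K : pzRingType) n (u : 'rV[K]_n) (a b : K) : 'rV[K]_(n + 1 + 1) :=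
  row_mx (row_mx u a%:M) b%:M.

Section Lift.
Variable n : nat.

Lemma lorentz_mrow (u v : 'rV[C]_n) (a b c d : C) :
  lorentz (mrow u a b) (mrow v c d) = dot u v + a * c - b * d.
Proof. by rewrite /mrow lorentz_row_mx dot_row_mx. Qed.

Lemma mrowD (K : pzRingType) (u v : 'rV[K]_n) (a b c d : K) :
  mrow u a b + mrow v c d = mrow (u + v) (a + c) (b + d).
Proof. by rewrite /mrow !add_row_mx -!raddfD. Qed.

Lemma mrowZ (K : comPzRingType) (k : K) (u : 'rV[K]_n) (a b : K) :
  k *: mrow u a b = mrow (k *: u) (k * a) (k * b).
Proof. by rewrite /mrow !scale_row_mx !scale_scalar_mx. Qed.

Lemma cplx_mrow (u : 'rV[R]_n) (a b : R) :
  cplx (mrow u a b) = mrow (cplx u) a%:C b%:C.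
Proof. by rewrite /mrow /cplx !map_row_mx !map_scalar_mx. Qed.

Lemma vconj_mrow (u : 'rV[C]_n) (a b : C) :
  vconj (mrow u a b) = mrow (vconj u) (a^*%C) (b^*%C).
Proof. by rewrite /mrow /vconj !map_row_mx !map_scalar_mx. Qed.

End Lift.
End BilinearForms.

Section VectorCalculus.
Variable R : realType.
Local Notation C := R[i].
Implicit Types (w : R * R) (t : C) (f : R * R -> C).

Definition vdiff m (F : R * R -> 'rV[C]_m) w :=
  forall j, cdiff (fun u => F u 0 j) w.

Definition vwd t m (F : R * R -> 'rV[C]_m) w : 'rV[C]_m :=
  \row_j wd t (fun u => F u 0 j) w.

Lemma vdzE m (F : R * R -> 'rV[C]_m) w : vdz F w = vwd (- 'i%C) F w.
Proof. by apply/rowP => j; rewrite !mxE dzE. Qed.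

Section Pointwise.
Variables (m : nat) (t : C) (w : R * R).
Implicit Types (F H : R * R -> 'rV[C]_m).

Lemma near_eq_vwd F H : {near w, F =1 H} -> vwd t F w = vwd t H w.
Proof.
move=> FH; apply/rowP => j; rewrite !mxE; apply: near_eq_wd.
by apply: filterS FH => u ->.
Qed.

Lemma vdiff_cst (c : 'rV[C]_m) : vdiff (fun=> c) w.
Proof. by move=> j; exact: cdiff_cst. Qed.

Lemma vwd_cst (c : 'rV[C]_m) : vwd t (fun=> c) w = 0.
Proof. by apply/rowP => j; rewrite !mxE wd_cst. Qed.

Lemma vwdD F H : vdiff F w -> vdiff H w ->
  vwd t (fun u => F u + H u) w = vwd t F w + vwd t H w.
Proof.
move=> dF dH; apply/rowP => j; rewrite !mxE -wdD //; congr (wd t _ w).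
by apply/funext => u; rewrite mxE.
Qed.

Lemma vdiffZ f F : cdiff f w -> vdiff F w -> vdiff (fun u => f u *: F u) w.
Proof.
move=> df dF j; rewrite (_ : (fun u => _) = (fun u => f u * F u 0 j)).
  exact: cdiffM.
by apply/funext => u; rewrite mxE.
Qed.

Lemma vwdZ f F : cdiff f w -> vdiff F w ->
  vwd t (fun u => f u *: F u) w = wd t f w *: F w + f w *: vwd t F w.
Proof.
move=> df dF; apply/rowP => j; rewrite !mxE -wdM //; congr (wd t _ w).
by apply/funext => u; rewrite mxE.
Qed.

Lemma vwdJ F : vdiff F w -> vwd t (fun u => vconj (F u)) w = vconj (vwd (t^*%C) F w).
Proof.
move=> dF; apply/rowP => j; rewrite !mxE -wdJ //; congr (wd t _ w).
by apply/funext => u; rewrite mxE.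
Qed.

Lemma cdiff_sum (I : Type) (r : seq I) (g : I -> R * R -> C) :
  (forall i, cdiff (g i) w) -> cdiff (fun u => \sum_(i <- r) g i u) w.
Proof.
move=> dg; elim: r => [|i r IH].
  rewrite (_ : (fun u => _) = (fun=> 0)); first exact: cdiff_cst.
  by apply/funext => u; rewrite big_nil.
rewrite (_ : (fun u => _) = (fun u => g i u + \sum_(i <- r) g i u)).
  exact: cdiffD.
by apply/funext => u; rewrite big_cons.
Qed.

Lemma wd_sum (I : Type) (r : seq I) (g : I -> R * R -> C) :
  (forall i, cdiff (g i) w) ->
  wd t (fun u => \sum_(i <- r) g i u) w = \sum_(i <- r) wd t (g i) w.
Proof.
move=> dg; elim: r => [|i r IH].
  rewrite big_nil (_ : (fun u => _) = (fun=> 0)) ?wd_cst //.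
  by apply/funext => u; rewrite big_nil.
rewrite big_cons -IH (_ : (fun u => _) = (fun u => g i u + \sum_(i <- r) g i u)).
  by rewrite wdD //; exact: cdiff_sum.
by apply/funext => u; rewrite big_cons.
Qed.

Lemma cdiff_dot F H : vdiff F w -> vdiff H w -> cdiff (fun u => dot (F u) (H u)) w.
Proof.
move=> dF dH; rewrite (_ : (fun u => _) = (fun u => \sum_j F u 0 j * H u 0 j)).
  by apply: cdiff_sum => j; exact: cdiffM.
by apply/funext => u; rewrite dotE.
Qed.

Lemma wd_dot F H : vdiff F w -> vdiff H w ->
  wd t (fun u => dot (F u) (H u)) w = dot (vwd t F w) (H w) + dot (F w) (vwd t H w).
Proof.
move=> dF dH; rewrite (_ : (fun u => _) = (fun u => \sum_j F u 0 j * H u 0 j)).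
  rewrite wd_sum; last by move=> j; exact: cdiffM.
  rewrite !dotE -big_split /=; apply: eq_bigr => j _.
  by rewrite wdM // !mxE.
by apply/funext => u; rewrite dotE.
Qed.

End Pointwise.

Section LiftCalculus.
Variables (t : C) (w : R * R).

Lemma row_mxP m1 (F H : 'rV[C]_(m1 + 1)) : (forall j, F 0 (lshift 1 j) = H 0 (lshift 1
  j)) ->
  F 0 (rshift m1 0) = H 0 (rshift m1 0) -> F = H.
Proof.
move=> lE rE; apply/rowP => j; case: (split_ordP j) => k -> //.
by rewrite (ord1 k).
Qed.

Lemma vdiff_row_mx m1 (F : R * R -> 'rV[C]_m1) f : vdiff F w -> cdiff f w ->
  vdiff (fun u => row_mx (F u) (f u)%:M) w.
Proof.
move=> dF df j; case: (split_ordP j) => k ->.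
  rewrite (_ : (fun u => _) = (fun u => F u 0 k)) //.
  by apply/funext => u; rewrite row_mxEl.
rewrite (_ : (fun u => _) = f) //.
by apply/funext => u; rewrite row_mxEr mxE !ord1 eqxx mulr1n.
Qed.

Lemma vwd_row_mx m1 (F : R * R -> 'rV[C]_m1) f :
  vwd t (fun u => row_mx (F u) (f u)%:M) w = row_mx (vwd t F w) (wd t f w)%:M.
Proof.
apply: row_mxP => [j|].
  rewrite row_mxEl !mxE; congr (wd t _ w).
  by apply/funext => u; rewrite row_mxEl.
rewrite row_mxEr !mxE eqxx mulr1n; congr (wd t _ w).
by apply/funext => u; rewrite row_mxEr mxE eqxx mulr1n.
Qed.

Variable n : nat.

Lemma vdiff_mrow (F : R * R -> 'rV[C]_n) f g : vdiff F w -> cdiff f w -> cdiff g w ->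
  vdiff (fun u => mrow (F u) (f u) (g u)) w.
Proof. by move=> dF df dg; do 2!apply: vdiff_row_mx => //. Qed.

Lemma vwd_mrow (F : R * R -> 'rV[C]_n) f g :
  vwd t (fun u => mrow (F u) (f u) (g u)) w = mrow (vwd t F w) (wd t f w) (wd t g w).
Proof. by rewrite /mrow !vwd_row_mx. Qed.

End LiftCalculus.

Section Smooth.
Variables (U : set (R * R)) (oU : open U).

Section Dim.
Variable m : nat.
Implicit Types (F H : R * R -> 'rV[C]_m).

Lemma vsmooth_diff F w : vsmooth U F -> U w -> vdiff F w.
Proof. by move=> sF Uw j; apply: csmooth_diff (sF j) Uw. Qed.

Lemma vsmooth_eq F H : (forall u, U u -> F u = H u) -> vsmooth U F -> vsmooth U H.
Proof. by move=> FH sF j; apply: csmooth_eq (sF j) => // u /FH ->. Qed.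

Lemma vsmooth_cst (c : 'rV[C]_m) : vsmooth U (fun=> c).
Proof. by move=> j; exact: csmooth_cst. Qed.

Lemma vsmoothD F H : vsmooth U F -> vsmooth U H -> vsmooth U (fun u => F u + H u).
Proof.
move=> sF sH j; apply: csmooth_eq (csmoothD oU (sF j) (sH j)) => // u _.
by rewrite mxE.
Qed.

Lemma vsmoothZ f F : csmooth U f -> vsmooth U F -> vsmooth U (fun u => f u *: F u).
Proof.
move=> sf sF j; apply: csmooth_eq (csmoothM oU sf (sF j)) => // u _.
by rewrite mxE.
Qed.

Lemma vsmoothN F : vsmooth U F -> vsmooth U (fun u => - F u).
Proof.
move=> sF; apply: vsmooth_eq (vsmoothZ (csmooth_cst U (-1)) sF) => u _.
by rewrite scaleN1r.
Qed.

Lemma vsmooth_vwd t F : vsmooth U F -> vsmooth U (vwd t F).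
Proof.
by move=> sF j; apply: csmooth_eq (csmooth_wd oU t (sF j)) => // u _; rewrite mxE.
Qed.

Lemma csmooth_dot F H : vsmooth U F -> vsmooth U H ->
  csmooth U (fun u => dot (F u) (H u)).
Proof.
move=> sF sH.
have key (r : seq 'I_m) : csmooth U (fun u => \sum_(j <- r) F u 0 j * H u 0 j).
  elim: r => [|j r IH].
    by apply: csmooth_eq (csmooth_cst U 0) => // u _; rewrite big_nil.
  apply: csmooth_eq (csmoothD oU (csmoothM oU (sF j) (sH j)) IH) => // u _.
  by rewrite big_cons.
by apply: csmooth_eq (key (index_enum 'I_m)) => // u _; rewrite dotE.
Qed.

Lemma vwd_commute s t F w : vsmooth U F -> U w ->
  vwd s (vwd t F) w = vwd t (vwd s F) w.
Proof.
move=> sF Uw; apply/rowP => j; rewrite !mxE.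
rewrite (_ : (fun u => vwd t F u 0 j) = wd t (fun u => F u 0 j)); last first.
  by apply/funext => u; rewrite mxE.
rewrite (_ : (fun u => vwd s F u 0 j) = wd s (fun u => F u 0 j)); last first.
  by apply/funext => u; rewrite mxE.
exact: wd_commute (sF j) Uw.
Qed.

End Dim.

Lemma vsmooth_row_mx m1 (F : R * R -> 'rV[C]_m1) f : vsmooth U F -> csmooth U f ->
  vsmooth U (fun u => row_mx (F u) (f u)%:M).
Proof.
move=> sF sf j; case: (split_ordP j) => k ->.
  by apply: csmooth_eq (sF k) => // u _; rewrite row_mxEl.
by apply: csmooth_eq sf => // u _; rewrite row_mxEr mxE !ord1 eqxx mulr1n.
Qed.

Lemma vsmooth_mrow n (F : R * R -> 'rV[C]_n) f g : vsmooth U F -> csmooth U f ->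
  csmooth U g -> vsmooth U (fun u => mrow (F u) (f u) (g u)).
Proof. by move=> sF sf sg; do 2!apply: vsmooth_row_mx => //. Qed.

End Smooth.
End VectorCalculus.

(** * The light cone over the Euclidean space *)

Section TangentLift.
Variables (R : realType) (n : nat).
Local Notation C := R[i].
Implicit Types (x u v : 'rV[C]_n).

(* [paraboloid x] spans the null line of the point with stereographic
   coordinate [x]; [tlift x u] is its derivative in the direction [u]. *)
Definition paraboloid x : 'rV[C]_(n + 1 + 1) :=
  mrow x ((dot x x - 1) / 2) ((dot x x + 1) / 2).

Definition tlift x u : 'rV[C]_(n + 1 + 1) := mrow u (dot x u) (dot x u).

Definition null_infty : 'rV[C]_(n + 1 + 1) := mrow 0 1 1.

Lemma tliftD x u v : tlift x (u + v) = tlift x u + tlift x v.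
Proof. by rewrite /tlift mrowD !dotDr. Qed.

Lemma tliftZ x (a : C) u : tlift x (a *: u) = a *: tlift x u.
Proof. by rewrite /tlift mrowZ !dotZr. Qed.

Lemma lorentz_tlift x u v : lorentz (tlift x u) (tlift x v) = dot u v.
Proof. by rewrite lorentz_mrow; ring. Qed.

Lemma lorentz_tlift_null_infty x u : lorentz (tlift x u) null_infty = 0.
Proof. by rewrite lorentz_mrow dot0r; ring. Qed.

Lemma lorentz_null_infty : lorentz null_infty null_infty = 0.
Proof. by rewrite lorentz_mrow dot0r; ring. Qed.

Lemma lorentz_paraboloid x : lorentz (paraboloid x) (paraboloid x) = 0.
Proof. by rewrite lorentz_mrow; field. Qed.

Lemma lorentz_paraboloid_tlift x u : lorentz (paraboloid x) (tlift x u) = 0.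
Proof. by rewrite lorentz_mrow; field. Qed.

Lemma lorentz_paraboloid_null_infty x : lorentz (paraboloid x) null_infty = -1.
Proof. by rewrite lorentz_mrow dot0r; field. Qed.

Lemma vconj_tlift x u : vconj x = x -> vconj (tlift x u) = tlift x (vconj u).
Proof. by move=> xR; rewrite vconj_mrow conjc_dot xR. Qed.

Lemma vconj_null_infty : vconj null_infty = null_infty.
Proof.
by rewrite vconj_mrow conjc1; congr mrow; apply/rowP => j; rewrite !mxE conjc0.
Qed.

Lemma vconj_paraboloid x : vconj x = x -> vconj (paraboloid x) = paraboloid x.
Proof.
move=> xR; rewrite vconj_mrow !conjcM !conjcD conjcN conjc_dot xR.
by rewrite conjc_inv conjc_nat conjc1.
Qed.

End TangentLift.

Arguments null_infty {R n}.

Section TangentCalculus.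
Variables (R : realType) (n : nat) (t : R[i]) (w : R * R).
Local Notation C := R[i].

(** The motion of the base point adds the same amount to each of the last two coordinates, that is a
    multiple of [null_infty]. *)
Lemma vwd_tlift (X F : R * R -> 'rV[C]_n) : vdiff X w -> vdiff F w ->
  vwd t (fun u => tlift (X u) (F u)) w =
  tlift (X w) (vwd t F w) + dot (vwd t X w) (F w) *: null_infty.
Proof.
move=> dX dF; rewrite vwd_mrow wd_dot // /tlift /null_infty mrowZ mrowD scaler0 addr0.
by rewrite mulr1 addrC.
Qed.

Lemma vdiff_paraboloid (X : R * R -> 'rV[C]_n) : vdiff X w ->
  vdiff (fun u => paraboloid (X u)) w.
Proof.
move=> dX; apply: vdiff_mrow => //; apply: cdiffM (cdiff_cst _ _);
  apply: cdiffD (cdiff_cst _ _); exact: cdiff_dot.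
Qed.

Lemma vwd_paraboloid (X : R * R -> 'rV[C]_n) : vdiff X w ->
  vwd t (fun u => paraboloid (X u)) w = tlift (X w) (vwd t X w).
Proof.
move=> dX; have dq : cdiff (fun u => dot (X u) (X u)) w by exact: cdiff_dot.
have E (c : C) : wd t (fun u => (dot (X u) (X u) + c) / 2) w = dot (X w) (vwd t X w).
  rewrite wdM ?wd_cst ?mulr0 ?addr0; last 2 first.
  - exact: cdiffD (cdiff_cst _ _).
  - exact: cdiff_cst.
  rewrite (wdD t dq (cdiff_cst c w)) wd_cst addr0.
  by rewrite wd_dot // (dotC (vwd t X w)); field.
by rewrite vwd_mrow !E.
Qed.

End TangentCalculus.

Section SmoothLift.
Variables (R : realType) (n : nat) (U : set (R * R)) (oU : open U).
Variable X : R * R -> 'rV[R[i]]_n.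
Hypothesis sX : vsmooth U X.

Lemma vsmooth_tlift F : vsmooth U F -> vsmooth U (fun u => tlift (X u) (F u)).
Proof. by move=> sF; apply: vsmooth_mrow => //; exact: csmooth_dot. Qed.

Lemma vsmooth_paraboloid : vsmooth U (fun u => paraboloid (X u)).
Proof.
apply: vsmooth_mrow => //; apply: csmoothM (csmooth_cst _ _) => //;
  apply: csmoothD (csmooth_cst _ _) => //; exact: csmooth_dot.
Qed.

End SmoothLift.

(** * Complexification of real subspaces *)

Section SubspaceFacts.
Variables (R : realType) (m : nat).
Local Notation C := R[i].
Implicit Types (A B : 'rV[C]_(m + 1)).

(** Kernels commute with extension of scalars, so the complexified real orthogonal complement is the
    orthogonal complement, for the complex bilinear form, of the complexified space. *)
Lemma cplx_kermx_lorentzP k (V : 'M[R]_(k, m + 1)) A :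
  reflect (forall B, (B <= cplx V)%MS -> lorentz A B = 0)
    (A <= cplx (kermx (lorentz_gram R m *m V^T)))%MS.
Proof.
have gE : map_mx (real_complex R) (lorentz_gram R m) = lorentz_gram C m.
  by rewrite /lorentz_gram map_block_mx map_mx1 !map_mx0 map_scalar_mx rmorphN rmorph1.
rewrite /cplx map_kermx map_mxM gE -map_trmx.
apply: (iffP sub_kermxP) => [AV B /submxP[D ->]|AV].
  by rewrite /lorentz trmx_mul !mulmxA -[A *m _ *m _]mulmxA AV mul0mx mxE.
apply/rowP => j; rewrite mulmxA.
have := AV (row j (map_mx (real_complex R) V)) (row_sub _ _).
by rewrite /lorentz tr_row colE mulmxA -colE [X in X = _ -> _]mxE => ->; rewrite mxE.
Qed.

End SubspaceFacts.

Section ComplexSpans.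
Variables (R : realType) (m : nat).
Local Notation C := R[i].
Implicit Types (v A : 'rV[C]_m).

Lemma sub_adds_rV k (W : 'M[C]_(k, m)) v A : (A <= W + v)%MS ->
  exists B a, (B <= W)%MS /\ A = B + a *: v.
Proof.
move=> /sub_addsmxP[[u1 u2] /= ->]; exists (u1 *m W), (u2 0 0).
by split; [exact: submxMl|rewrite [u2 in LHS]mx11_scalar mul_scalar_mx].
Qed.

Lemma cplx_ReE v : cplx (map_mx (@complex.Re R) v) = 2^-1 *: (v + vconj v).
Proof. by apply/rowP => j; rewrite !mxE ReJ_add mulrC. Qed.

Lemma cplx_ImE v : cplx (map_mx (@complex.Im R) v) = ('i%C / 2) *: (vconj v - v).
Proof. by apply/rowP => j; rewrite !mxE ImJ_sub mulrAC -mulrA mulrC. Qed.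

Lemma cplx_Re_Im v : v = cplx (map_mx (@complex.Re R) v)
  + 'i%C *: cplx (map_mx (@complex.Im R) v).
Proof. by apply/rowP => j; rewrite !mxE -complexE. Qed.

Lemma submx_cplx k (W : 'M[R]_(k, m)) (u : 'rV[R]_m) :
  (u <= W)%MS -> (cplx u <= cplx W)%MS.
Proof. by rewrite /cplx map_submx. Qed.

(** [Vbundle] is generated by real and imaginary parts; this recovers Y_z and Y_zb in its
    complexification. *)
Lemma submx_Re_Im k (W : 'M[R]_(k, m)) v :
  (map_mx (@complex.Re R) v <= W)%MS -> (map_mx (@complex.Im R) v <= W)%MS ->
  (v <= cplx W)%MS /\ (vconj v <= cplx W)%MS.
Proof.
move=> /submx_cplx vR /submx_cplx vI; split.
  by rewrite (cplx_Re_Im v) addmx_sub // scalemx_sub.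
rewrite (cplx_Re_Im v) vconjD vconjZ; rewrite !vconj_cplx.
by rewrite addmx_sub // scalemx_sub.
Qed.

End ComplexSpans.

(** * Coordinates with respect to four vectors *)

Section Combinations.
Variables (R : realType) (m : nat).
Local Notation C := R[i].

Section Comb4.
Variables (g u v p : 'rV[C]_m).

Definition comb4 (a b c d : C) := a *: g + b *: u + c *: v + d *: p.

Lemma comb4E a b c d : comb4 a b c d = a *: g + b *: u + c *: v + d *: p.
Proof. by []. Qed.

Lemma comb4D a b c d a' b' c' d' : comb4 a b c d + comb4 a' b' c' d' =
  comb4 (a + a') (b + b') (c + c') (d + d').
Proof. by apply/rowP => j; rewrite !mxE; ring. Qed.

Lemma comb4Z k a b c d : k *: comb4 a b c d = comb4 (k * a) (k * b) (k * c) (k * d).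
Proof. by apply/rowP => j; rewrite !mxE; ring. Qed.

Lemma comb4B a b c d a' b' c' d' : comb4 a b c d - comb4 a' b' c' d' =
  comb4 (a - a') (b - b') (c - c') (d - d').
Proof. by apply/rowP => j; rewrite !mxE; ring. Qed.

End Comb4.

Lemma vconj_comb4_swap g u v p a b c d : vconj g = g -> vconj u = v -> vconj v = u ->
  vconj p = p ->
  vconj (comb4 g u v p a b c d) = comb4 g u v p a^*%C c^*%C b^*%C d^*%C.
Proof.
move=> gE uE vE pE; rewrite /comb4 !vconjD !vconjZ gE uE vE pE.
by congr (_ + _); rewrite addrAC.
Qed.

Lemma vsmooth_comb4 (U : set (R * R)) (g u v p : R * R -> 'rV[C]_m) a b c d : open U ->
  vsmooth U g -> vsmooth U u -> vsmooth U v -> vsmooth U p ->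
  csmooth U a -> csmooth U b -> csmooth U c -> csmooth U d ->
  vsmooth U (fun w => comb4 (g w) (u w) (v w) (p w) (a w) (b w) (c w) (d w)).
Proof.
move=> oU sg su sv sp sa sb sc sd.
exact (vsmoothD oU (vsmoothD oU (vsmoothD oU (vsmoothZ oU sa sg) (vsmoothZ oU sb su))
  (vsmoothZ oU sc sv)) (vsmoothZ oU sd sp)).
Qed.

Lemma submx_comb4 k (W : 'M[C]_(k, m)) g u v p a b c d : (g <= W)%MS -> (u <= W)%MS ->
  (v <= W)%MS -> (p <= W)%MS -> (comb4 g u v p a b c d <= W)%MS.
Proof. by move=> Wg Wu Wv Wp; rewrite !addmx_sub // scalemx_sub. Qed.

Lemma comb4_g g u v p a : comb4 g u v p a 0 0 0 = a *: g.
Proof. by rewrite /comb4 !scale0r !addr0. Qed.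

Lemma comb4_gu g u v p a b : comb4 g u v p a b 0 0 = a *: g + b *: u.
Proof. by rewrite /comb4 !scale0r !addr0. Qed.

Lemma comb4_gv g u v p a b : comb4 g u v p a 0 b 0 = a *: g + b *: v.
Proof. by rewrite /comb4 !scale0r !addr0. Qed.

(** The four given vectors stand for Y, Y_z, Y_zb and Y_{z zb}. Their coefficient matrix is
    triangular with nonzero diagonal [l], [l1], [l2], [r], so [g], [u], [v], [p] are recovered in
    turn, whatever the entries below the diagonal. *)
Lemma span_comb4 k (W : 'M[C]_(k, m)) g u v p l z1 z2 l1 l2 e b1 b2 r :
  l != 0 -> l1 != 0 -> l2 != 0 -> r != 0 ->
  (comb4 g u v p l 0 0 0 <= W)%MS -> (comb4 g u v p z1 l1 0 0 <= W)%MS ->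
  (comb4 g u v p z2 0 l2 0 <= W)%MS -> (comb4 g u v p e b1 b2 r <= W)%MS ->
  forall a b c d, (comb4 g u v p a b c d <= W)%MS.
Proof.
move=> l0 l10 l20 r0 H1 H2 H3 H4 a b c d.
have cancel (B y : 'rV[C]_m) t : t != 0 -> (B <= W)%MS ->
    ((B + t *: y)%R <= W)%MS -> (y <= W)%MS.
  move=> t0 WB WBy; have -> : y = t^-1 *: ((B + t *: y) - B).
    by rewrite addrC addKr scalerA mulVf // scale1r.
  by apply: scalemx_sub; apply: addmx_sub => //; rewrite eqmx_opp.
rewrite comb4_g in H1; rewrite comb4_gu in H2; rewrite comb4_gv in H3.
have Wg : (g <= W)%MS by apply: (cancel 0 _ _ l0 (sub0mx _ _)); rewrite add0r.
have Wu : (u <= W)%MS by apply: (cancel _ _ _ l10 _ H2); exact: scalemx_sub.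
have Wv : (v <= W)%MS by apply: (cancel _ _ _ l20 _ H3); exact: scalemx_sub.
have Wp : (p <= W)%MS.
  by apply: (cancel _ _ _ r0 _ H4); rewrite !addmx_sub // scalemx_sub.
exact: submx_comb4.
Qed.

Lemma submx_comb4P g u v p A :
  (A <= (((g + u)%MS + v)%MS + p)%MS)%MS -> exists a b c d, A = comb4 g u v p a b c d.
Proof.
move=> /sub_adds_rV[B [d [+ ->]]] => /sub_adds_rV[B2 [c [+ ->]]].
move=> /sub_adds_rV[B3 [b [/sub_rVP[a ->] ->]]].
by exists a, b, c, d.
Qed.

Lemma submx_adds4 (g u v p : 'rV[C]_m) (W := (((g + u)%MS + v)%MS + p)%MS) :
  [/\ (g <= W)%MS, (u <= W)%MS, (v <= W)%MS & (p <= W)%MS].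
Proof.
have : (W <= W)%MS by exact: submx_refl.
by rewrite {1}/W !addsmx_sub => /andP[/andP[/andP[WG Wz] Wb] Wp].
Qed.

Lemma cplx_adds4_sub k (W : 'M[C]_(k, m)) (g u v p : 'rV[R]_m) :
  (cplx g <= W)%MS -> (cplx u <= W)%MS -> (cplx v <= W)%MS -> (cplx p <= W)%MS ->
  (cplx (((g + u)%MS + v)%MS + p)%MS <= W)%MS.
Proof.
rewrite /cplx => Wg Wu Wv Wp.
by rewrite !(map_addsmx, addsmx_sub) Wg Wu Wv Wp.
Qed.

End Combinations.

Section LorentzCombinations.
Variables (R : realType) (m : nat).
Local Notation C := R[i].
Variables (g u v p : 'rV[C]_(m + 1)).

Lemma lorentz_comb4r z a b c d : lorentz z (comb4 g u v p a b c d) =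
  a * lorentz z g + b * lorentz z u + c * lorentz z v + d * lorentz z p.
Proof. by rewrite /comb4 !lorentzDr !lorentzZr. Qed.

Lemma lorentz_comb4r0 z a b c d : lorentz z g = 0 -> lorentz z u = 0 ->
  lorentz z v = 0 -> lorentz z p = 0 -> lorentz z (comb4 g u v p a b c d) = 0.
Proof. by rewrite lorentz_comb4r => -> -> -> ->; rewrite !mulr0 !addr0. Qed.

Lemma lorentz_comb2 a b z : lorentz (a *: g + b *: u) z = a * lorentz g z + b *
  lorentz u z.
Proof. by rewrite lorentzDl !lorentzZl. Qed.

Lemma lorentz_comb2E a b z k l : lorentz g z = k -> lorentz u z = l ->
  lorentz (a *: g + b *: u) z = a * k + b * l.
Proof. by rewrite lorentz_comb2 => -> ->. Qed.

Lemma lorentz_comb2_0 a b z : lorentz g z = 0 -> lorentz u z = 0 ->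
  lorentz (a *: g + b *: u) z = 0.
Proof. by rewrite lorentz_comb2 => -> ->; rewrite !mulr0 addr0. Qed.

Lemma lorentz_comb2_null a b : lorentz g g = 0 -> lorentz g u = 0 -> lorentz u u = 0 ->
  lorentz (a *: g + b *: u) (a *: g + b *: u) = 0.
Proof.
move=> g_g gu uu; rewrite lorentz_comb2 !(lorentzC _ (_ + _)) !lorentz_comb2.
by rewrite (lorentzC u g) g_g gu uu !mulr0 !addr0 !mulr0 addr0.
Qed.

(** The hypotheses describe two mutually orthogonal pairs of null vectors, [g, p] and [u, v], so
    only products within a pair survive. *)
Lemma lorentz_comb4 r a b c d a' b' c' d' :
  lorentz g g = 0 -> lorentz g u = 0 -> lorentz g v = 0 -> lorentz g p = -1 ->
  lorentz u u = 0 -> lorentz u v = r -> lorentz u p = 0 ->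
  lorentz v v = 0 -> lorentz v p = 0 -> lorentz p p = 0 ->
  lorentz (comb4 g u v p a b c d) (comb4 g u v p a' b' c' d') =
  (b * c' + c * b') * r - (a * d' + d * a').
Proof.
move=> g_g gu gv gp uu uv up vv vp pp; rewrite lorentz_comb4r !(lorentzC (comb4 _ _ _
  _ _ _ _ _)).
rewrite !lorentz_comb4r (lorentzC u g) (lorentzC v g) (lorentzC p g) (lorentzC v u).
rewrite (lorentzC p u) (lorentzC p v) g_g gu gv gp uu uv up vv vp pp; ring.
Qed.

End LorentzCombinations.

Section FrameAlgebra.
Variables (R : realType).
Local Notation C := R[i].

Lemma vwd_eq_on m (U : set (R * R)) t (F H : R * R -> 'rV[C]_m) w :
  open U -> U w -> (forall u, U u -> F u = H u) -> vwd t F w = vwd t H w.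
Proof.
move=> oU Uw FH; apply: near_eq_vwd.
by apply: filterS (open_nbhs_nbhs (conj oU Uw)) => u /FH.
Qed.

Lemma wd_eq_on (U : set (R * R)) t (f h : R * R -> C) w :
  open U -> U w -> (forall u, U u -> f u = h u) -> wd t f w = wd t h w.
Proof.
move=> oU Uw fh; apply: near_eq_wd.
by apply: filterS (open_nbhs_nbhs (conj oU Uw)) => u /fh.
Qed.

Lemma vwd_comb2 m t w (F H : R * R -> 'rV[C]_m) f h f' h' F' H' :
  cdiff f w -> vdiff F w -> cdiff h w -> vdiff H w ->
  wd t f w = f' -> vwd t F w = F' -> wd t h w = h' -> vwd t H w = H' ->
  vwd t (fun u => f u *: F u + h u *: H u) w =
  f' *: F w + f w *: F' + (h' *: H w + h w *: H').
Proof.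
move=> df dF dh dH <- <- <- <-.
by rewrite vwdD ?vwdZ //; apply: vdiffZ.
Qed.

Lemma vwdZE m t w (F : R * R -> 'rV[C]_m) f f' F' : cdiff f w -> vdiff F w ->
  wd t f w = f' -> vwd t F w = F' ->
  vwd t (fun u => f u *: F u) w = f' *: F w + f w *: F'.
Proof. by move=> df dF <- <-; rewrite vwdZ. Qed.

Lemma wd_div t w (f g : R * R -> C) f' g' : cdiff f w -> cdiff g w ->
  cdiff (fun u => (g u)^-1) w ->
  (\forall u \near w, g u != 0) -> wd t f w = f' -> wd t g w = g' ->
  wd t (fun u => f u / g u) w = f' / g w - f w * g' / g w ^+ 2.
Proof.
move=> df dg dV g0 <- <-; rewrite wdM // wdV //.
have := nbhs_singleton g0.
by move: (wd t f w) (wd t g w) (f w) (g w) => a b c l l0; field.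
Qed.

Lemma wd_Zl t w (c : C) f : cdiff f w -> wd t (fun u => c * f u) w = c * wd t f w.
Proof. by move=> df; rewrite wdM ?wd_cst ?mul0r ?add0r //; exact: cdiff_cst. Qed.

Lemma vdz_wd m : @vdz R m = @vwd R (- 'i%C) m.
Proof. by apply/funext => F; apply/funext => w; rewrite vdzE. Qed.

Lemma vdzb_wd m : @vdzb R m = @vwd R 'i%C m.
Proof. by []. Qed.

Lemma dz_wd : @dz R = @wd R (- 'i%C).
Proof. by apply/funext => f; apply/funext => w; rewrite dzE. Qed.

Lemma conjcNi : (- 'i%C : C)^*%C = 'i%C.
Proof. by apply: complexP; rewrite /= ?oppr0 ?opprK. Qed.

Lemma conjci : ('i%C : C)^*%C = - 'i%C.
Proof. by apply: complexP; rewrite /= ?oppr0. Qed.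

Lemma vwd_tlift0 n t (X F : R * R -> 'rV[C]_n) w : vdiff X w -> vdiff F w ->
  vwd t F w = 0 ->
  vwd t (fun u => tlift (X u) (F u)) w = dot (F w) (vwd t X w) *: null_infty.
Proof.
move=> dX dF F0; rewrite vwd_tlift // F0 dotC -[RHS]add0r; congr (_ + _).
by have := tliftZ (X w) 0 (0 : 'rV[C]_n); rewrite !scale0r.
Qed.

(** These are the coefficients of [Ncplx]: conjugation swaps the middle two and fixes the outer two,
    which makes N real. *)
Lemma conjc_N_coefs (l z b : C) : l^*%C = l -> z^*%C = b -> b^*%C = z ->
  [/\ (2 * z * b / l)^*%C = 2 * z * b / l, (2 * b)^*%C = 2 * z,
      (2 * z)^*%C = 2 * b & (l^-1)^*%C = l^-1].
Proof.
move=> lE zE bE; rewrite !conjcM !conjc_inv lE zE bE conjc_nat; split=> //.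
by rewrite (mulrAC 2).
Qed.

Lemma conjc_mu (r g l z b : C) : r^*%C = r -> l^*%C = l -> z^*%C = b ->
  (- 2 * r / g + - 2 * z / l)^*%C = - 2 * r / g^*%C + - 2 * b / l.
Proof.
by move=> rE lE zE; rewrite conjcD !conjcM !conjc_inv rE lE zE conjcN conjc_nat.
Qed.

Lemma conjc_factor (l g : C) : l^*%C = l ->
  (2^-1 * l^-1 ^+ 3 * (g * g^*%C)^-1)^*%C = 2^-1 * l^-1 ^+ 3 * (g * g^*%C)^-1.
Proof.
move=> lE; rewrite 3!exprS expr0 mulr1 !conjcM !conjc_inv !conjcM conjcK lE conjc_nat.
by rewrite (mulrC (g^*%C)).
Qed.

Lemma vconj_pedal m (X u v : 'rV[C]_m) (g r : C) : vconj X = X -> vconj u = v ->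
  vconj v = u -> r^*%C = r ->
  vconj (X - (g / r) *: u - (g^*%C / r) *: v) = X - (g / r) *: u - (g^*%C / r) *: v.
Proof.
move=> XE uE vE rE; rewrite !vconjD !vconjN !vconjZ XE uE vE !conjcM !conjc_inv conjcK
  rE.
exact: addrAC.
Qed.

(** The paraboloid is quadratic in its base point, so its second-order Taylor expansion is exact,
    with the quadratic term along [null_infty]. *)
Lemma paraboloidD n (x u : 'rV[C]_n) :
  paraboloid (x + u) = paraboloid x + tlift x u + (dot u u / 2) *: null_infty.
Proof.
rewrite /paraboloid /tlift /null_infty mrowZ !mrowD scaler0 addr0 !dotDl !dotDr (dotC
  u x).
by congr mrow; field.
Qed.

(** The displacement combines two null vectors, so half its square is the cross term [g * h / r]
    alone. *)
Lemma paraboloid_pedal_step n (x u v : 'rV[C]_n) (g h r : C) : r != 0 ->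
  dot u u = 0 -> dot v v = 0 -> dot u v = r ->
  paraboloid (x - (g / r) *: u - (h / r) *: v) =
  comb4 (paraboloid x) (tlift x u) (tlift x v) null_infty 1 (- (g / r)) (- (h / r)) (g
    * h / r).
Proof.
move=> r0 uu vv uv.
rewrite -addrA -(scaleNr (g / r) u) -(scaleNr (h / r) v) paraboloidD tliftD !tliftZ
  /comb4 scale1r !addrA.
congr (_ + _ *: _).
by rewrite !(dotDl, dotDr, dotZl, dotZr) uu vv (dotC v u) uv; field.
Qed.

End FrameAlgebra.

(** * The moving frame in one coordinate patch *)

Section Frame.
(* Otherwise unification compares distinct frame vectors entry by entry. *)
Local Opaque vwd wd dot tlift vconj.
Variables (R : realType) (n : nat) (x : R * R -> 'rV[R]_n).
Local Notation C := R[i].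
Local Notation dd := (- 'i%C : C).
Local Notation db := ('i%C : C).

(* [rho], [lam] and [Gf] are rho, lam and G of the header; a suffix z or b denotes
   the derivative in z or in zbar. *)
Definition ambient w : 'rV[C]_n := cplx (x w).
Local Notation X := ambient.
Definition Xz := vwd dd X.
Definition Xb := vwd db X.
Definition Xzz := vwd dd Xz.
Definition rho w : C := dot (Xz w) (Xb w).
Definition lam_real w : R := (Num.sqrt (2 * complex.Re (rho w)))^-1.
Definition lam w : C := (lam_real w)%:C.
Definition lamz := wd dd lam.
Definition lamb := wd db lam.

Definition Gf w := paraboloid (X w).
Definition Gz w := tlift (X w) (Xz w).
Definition Gb w := tlift (X w) (Xb w).
Definition Gzz w := tlift (X w) (Xzz w).

Definition sqnorm (y : 'rV[R]_n) : R := (y *m y^T) 0 0.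
(** Written over the reals because a canonical lift is real-valued; its complexification is
    [lam *: Gf]. *)
Definition Ylift w : 'rV[R]_(n + 1 + 1) :=
  lam_real w *: mrow (x w) ((sqnorm (x w) - 1) / 2) ((sqnorm (x w) + 1) / 2).
Definition kappa w : 'rV[C]_(n + 1 + 1) := lam w *: Gzz w + (2 * lamz w) *: Gz w.
Definition schwarzian w : C := - 2 * wd dd lamz w / lam w.
Variable U : set (R * R).
Hypothesis oU : open U.
Hypothesis sX : vsmooth U X.
Hypothesis XzXz : forall w, U w -> dot (Xz w) (Xz w) = 0.
Hypothesis rho_pos : forall w, U w -> 0 < rho w.
Hypothesis XzXb : forall w, U w -> vwd db Xz w = 0.
Hypothesis XzzXzz : forall w, U w -> dot (Xzz w) (Xzz w) = 0.

Lemma vconjX w : vconj (X w) = X w.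
Proof. exact: vconj_cplx. Qed.

Lemma smooth_Xz : vsmooth U Xz. Proof. exact: vsmooth_vwd. Qed.
Lemma smooth_Xb : vsmooth U Xb. Proof. exact: vsmooth_vwd. Qed.
Lemma smooth_Xzz : vsmooth U Xzz. Proof. apply: vsmooth_vwd => //; exact: smooth_Xz.
Qed.

Lemma vdiff_X w : U w -> vdiff X w. Proof. exact: vsmooth_diff. Qed.
Lemma vdiff_Xz w : U w -> vdiff Xz w. Proof. exact: vsmooth_diff smooth_Xz. Qed.
Lemma vdiff_Xb w : U w -> vdiff Xb w. Proof. exact: vsmooth_diff smooth_Xb. Qed.
Lemma vdiff_Xzz w : U w -> vdiff Xzz w. Proof. exact: vsmooth_diff smooth_Xzz. Qed.

Lemma vconj_Xz w : U w -> vconj (Xz w) = Xb w.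
Proof.
move=> Uw; rewrite /Xz /Xb -conjci -[X in X = _]vconjK.
rewrite -[in LHS](vwdJ _ (vdiff_X Uw)) vconjK; apply: (vwd_eq_on _ oU Uw) => u _.
exact: vconjX.
Qed.

Lemma vconj_Xb w : U w -> vconj (Xb w) = Xz w.
Proof. by move=> Uw; rewrite -vconj_Xz // vconjK. Qed.

Lemma XbXb w : U w -> dot (Xb w) (Xb w) = 0.
Proof. by move=> Uw; rewrite -vconj_Xz // -conjc_dot XzXz // conjc0. Qed.

Lemma vwd_Xb w : U w -> vwd dd Xb w = 0.
Proof. by move=> Uw; rewrite /Xb (vwd_commute oU _ _ sX Uw) XzXb. Qed.

Lemma vwd_Xzz w : U w -> vwd db Xzz w = 0.
Proof.
move=> Uw; rewrite /Xzz (vwd_commute oU _ _ smooth_Xz Uw).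
by rewrite (@vwd_eq_on _ _ U _ _ (fun=> 0)) ?vwd_cst.
Qed.

Lemma rhoE w : U w -> rho w = (complex.Re (rho w))%:C.
Proof.
move=> /rho_pos; rewrite ltcE /= => /andP[/eqP rI _].
by apply: complexP => //=; rewrite -rI.
Qed.

Lemma conj_rho w : U w -> (rho w)^*%C = rho w.
Proof. by move=> Uw; rewrite (rhoE Uw) conjc_real. Qed.

Lemma Re_rho_gt0 w : U w -> 0 < complex.Re (rho w).
Proof. by move=> /rho_pos; rewrite ltcE /= => /andP[]. Qed.

Lemma rho_neq0 w : U w -> rho w != 0.
Proof. by move=> /rho_pos; rewrite lt_def => /andP[]. Qed.

Lemma smooth_rho : csmooth U rho.
Proof. apply: csmooth_dot => //; [exact: smooth_Xz|exact: smooth_Xb]. Qed.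

Lemma smooth_lam_real : smooth U lam_real.
Proof.
have pos w : U w -> 0 < 2 * complex.Re (rho w).
  by move=> Uw; rewrite mulr_gt0 // Re_rho_gt0.
apply: smoothV => // [w Uw|]; first by rewrite gt_eqF // sqrtr_gt0 pos.
apply: smooth_sqrt => //; apply: smoothM => //; first exact: smooth_cst.
by have [] := smooth_rho.
Qed.

Lemma lam_real_gt0 w : U w -> 0 < lam_real w.
Proof. by move=> Uw; rewrite invr_gt0 sqrtr_gt0 mulr_gt0 // Re_rho_gt0. Qed.

Lemma smooth_lam : csmooth U lam. Proof. exact: csmooth_real smooth_lam_real. Qed.
Lemma smooth_lamz : csmooth U lamz. Proof. exact: csmooth_wd smooth_lam. Qed.
Lemma smooth_lamb : csmooth U lamb. Proof. exact: csmooth_wd smooth_lam. Qed.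

Lemma cdiff_lam w : U w -> cdiff lam w. Proof. exact: csmooth_diff smooth_lam. Qed.
Lemma cdiff_lamz w : U w -> cdiff lamz w. Proof. exact: csmooth_diff smooth_lamz. Qed.
Lemma cdiff_lamb w : U w -> cdiff lamb w. Proof. exact: csmooth_diff smooth_lamb. Qed.

Lemma lam_neq0 w : U w -> lam w != 0.
Proof. by move=> Uw; rewrite (inj_eq (@complexI R)) gt_eqF // lam_real_gt0. Qed.

Lemma rho_lam w : U w -> rho w = (2 * lam w ^+ 2)^-1.
Proof.
move=> Uw; have r0 := Re_rho_gt0 Uw; have r20 : 0 <= 2 * complex.Re (rho w) by lra.
have E : 2 * lam_real w ^+ 2 = (complex.Re (rho w))^-1.
  by rewrite /lam_real exprVn sqr_sqrtr //; field; rewrite gt_eqF.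
have : ((2 * lam_real w ^+ 2)%:C : C) = ((complex.Re (rho w))^-1)%:C by rewrite E.
rewrite rmorphM rmorphXn /= rmorph_nat -/(lam w) => ->.
by rewrite fmorphV invrK /= -rhoE.
Qed.

Lemma conj_lam w : (lam w)^*%C = lam w.
Proof. exact: conjc_real. Qed.

Lemma conj_wd_lam t w : U w -> (wd t lam w)^*%C = wd (t^*%C) lam w.
Proof.
move=> Uw; rewrite -[t in LHS]conjcK -(wdJ _ (cdiff_lam Uw)).
by apply: (wd_eq_on _ oU Uw) => u _; exact: conj_lam.
Qed.

Lemma conj_lamz w : U w -> (lamz w)^*%C = lamb w.
Proof. by move=> Uw; rewrite conj_wd_lam // conjcNi. Qed.

Lemma conj_lamb w : U w -> (lamb w)^*%C = lamz w.
Proof. by move=> Uw; rewrite conj_wd_lam // conjci. Qed.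

Lemma conj_lamzz w : U w -> (wd dd lamz w)^*%C = wd db lamb w.
Proof.
move=> Uw; rewrite -[db in RHS]conjcK -[X in _ = X]conjcK; congr (_^*%C).
rewrite -wdJ ?conjci; last exact: cdiff_lamb.
by apply: (wd_eq_on _ oU Uw) => u Uu; rewrite conj_lamb.
Qed.

(** Obtained by differentiating [rho * lam ^+ 2 = 2^-1] and dividing by [lam]. Every later
    cancellation of rho_z rests on it. *)
Lemma wd_rho_lam w : U w -> lam w * wd dd rho w + 2 * rho w * lamz w = 0.
Proof.
move=> Uw; have l0 := lam_neq0 Uw.
have cl := cdiff_lam Uw; have cr : cdiff rho w by exact: csmooth_diff smooth_rho Uw.
have : wd dd (fun u => rho u * (lam u * lam u)) w = 0.
  rewrite (@wd_eq_on _ U _ _ (fun=> 2^-1)) ?wd_cst // => u Uu.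
  by rewrite rho_lam //; have := lam_neq0 Uu; move: (lam u) => l l1; field.
rewrite wdM //; last exact: cdiffM.
rewrite wdM // -/lamz; move: (wd dd rho w) (rho w) (lam w) (lamz w) l0 => a r l z l0.
by move=> E; apply: (mulfI l0); rewrite mulr0 -E; ring.
Qed.

Lemma wd_rho_dot w : U w -> wd dd rho w = dot (Xzz w) (Xb w).
Proof.
move=> Uw; rewrite wd_dot ?vwd_Xb ?dot0r ?addr0 //; [exact: vdiff_Xz|exact: vdiff_Xb].
Qed.

Lemma XzzXz w : U w -> dot (Xzz w) (Xz w) = 0.
Proof.
move=> Uw; have : wd dd (fun u => dot (Xz u) (Xz u)) w = 0.
  by rewrite (@wd_eq_on _ U _ _ (fun=> 0)) ?wd_cst.
have vz := vdiff_Xz Uw; rewrite wd_dot // -/Xzz (dotC (Xz w)) -mulr2n => /eqP.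
by rewrite mulrn_eq0 /= => /eqP.
Qed.

Lemma vwd_Gf t w : U w -> vwd t Gf w = tlift (X w) (vwd t X w).
Proof. by move=> Uw; rewrite vwd_paraboloid //; exact: vdiff_X. Qed.

Lemma vwd_Gz w : U w -> vwd dd Gz w = Gzz w.
Proof.
move=> Uw; rewrite vwd_tlift; [|exact: vdiff_X|exact: vdiff_Xz].
by rewrite -/Xz XzXz // scale0r addr0.
Qed.

Lemma vwdb_Gz w : U w -> vwd db Gz w = rho w *: null_infty.
Proof. by move=> Uw; exact: vwd_tlift0 (vdiff_X Uw) (vdiff_Xz Uw) (XzXb Uw). Qed.

Lemma vwdb_Gzz w : U w -> vwd db Gzz w = wd dd rho w *: null_infty.
Proof.
move=> Uw; rewrite (wd_rho_dot Uw).
exact: vwd_tlift0 (vdiff_X Uw) (vdiff_Xzz Uw) (vwd_Xzz Uw).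
Qed.

Lemma smooth_Gf : vsmooth U Gf. Proof. exact: vsmooth_paraboloid. Qed.
Lemma smooth_Gz : vsmooth U Gz. Proof. apply: vsmooth_tlift => //; exact: smooth_Xz.
Qed.
Lemma smooth_Gb : vsmooth U Gb. Proof. apply: vsmooth_tlift => //; exact: smooth_Xb.
Qed.
Lemma smooth_Gzz : vsmooth U Gzz. Proof. apply: vsmooth_tlift => //; exact:
  smooth_Xzz. Qed.

Lemma vconj_Gf w : vconj (Gf w) = Gf w.
Proof. by rewrite vconj_paraboloid // vconjX. Qed.

Lemma vconj_Gz w : U w -> vconj (Gz w) = Gb w.
Proof. by move=> Uw; rewrite /Gz (vconj_tlift _ (vconjX w)) (vconj_Xz Uw). Qed.

Lemma vconj_Gb w : U w -> vconj (Gb w) = Gz w.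
Proof. by move=> Uw; rewrite /Gb (vconj_tlift _ (vconjX w)) (vconj_Xb Uw). Qed.

Lemma cplx_Ylift w : cplx (Ylift w) = lam w *: Gf w.
Proof.
have E1 (a : R) : ((a - 1) / 2)%:C = (a%:C - 1) / 2 :> C.
  by rewrite rmorphM rmorphB fmorphV rmorph_nat rmorph1.
have E2 (a : R) : ((a + 1) / 2)%:C = (a%:C + 1) / 2 :> C.
  by rewrite rmorphM rmorphD fmorphV rmorph_nat rmorph1.
rewrite /cplx /Ylift map_mxZ -/(cplx _) cplx_mrow /Gf /paraboloid cplx_dot E1 E2.
by [].
Qed.

Lemma smooth_Ylift : vsmooth U (fun w => cplx (Ylift w)).
Proof.
by apply: vsmooth_eq (vsmoothZ oU smooth_lam smooth_Gf) => // u _; rewrite cplx_Ylift.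
Qed.

Lemma vwd_Ylift t w : U w ->
  vwd t (fun w => cplx (Ylift w)) w = wd t lam w *: Gf w + lam w *: vwd t Gf w.
Proof.
move=> Uw; rewrite (@vwd_eq_on _ _ U _ _ (fun u => lam u *: Gf u) w oU Uw).
  by rewrite vwdZ //; [exact: cdiff_lam|exact: vsmooth_diff smooth_Gf Uw].
by move=> u _; exact: cplx_Ylift.
Qed.

Lemma Lz_Ylift w : U w -> Lz Ylift w = lamz w *: Gf w + lam w *: Gz w.
Proof. by move=> Uw; rewrite /Lz vdz_wd (vwd_Ylift _ Uw) (vwd_Gf _ Uw). Qed.

Lemma Lzb_Ylift w : U w -> Lzb Ylift w = lamb w *: Gf w + lam w *: Gb w.
Proof. by move=> Uw; rewrite /Lzb vdzb_wd (vwd_Ylift _ Uw) (vwd_Gf _ Uw). Qed.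

Lemma vwd_Lz t w : U w -> vwd t (Lz Ylift) w =
  wd t lamz w *: Gf w + lamz w *: vwd t Gf w
  + (wd t lam w *: Gz w + lam w *: vwd t Gz w).
Proof.
move=> Uw.
rewrite (@vwd_eq_on _ _ U _ _ (fun u => lamz u *: Gf u + lam u *: Gz u) w oU Uw
  Lz_Ylift).
have dG := vsmooth_diff smooth_Gf Uw; have dGz := vsmooth_diff smooth_Gz Uw.
have dl := cdiff_lam Uw; have dlz := cdiff_lamz Uw.
by rewrite vwdD ?vwdZ //; apply: vdiffZ.
Qed.

Lemma Lz_z w : U w -> vdz (Lz Ylift) w = - (schwarzian w / 2) *: cplx (Ylift w) +
  kappa w.
Proof.
move=> Uw; rewrite vdz_wd (vwd_Lz _ Uw) (vwd_Gf _ Uw) (vwd_Gz Uw) cplx_Ylift /kappa.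
rewrite -[tlift (X w) _]/(Gz w) -/lamz scalerA.
have -> : - (schwarzian w / 2) * lam w = wd dd lamz w.
  rewrite /schwarzian; have := lam_neq0 Uw; move: (lam w) (wd _ _ _) => l z l0.
  by field.
move: (wd _ _ _) (lamz w) (lam w) (Gf w) (Gz w) (Gzz w) => a b c g gz gzz.
by apply/rowP => j; rewrite !mxE; ring.
Qed.

(** The coefficient [lam * rho] is never zero, so V contains the constant vector [null_infty], and V
    can be described by the vectors on the right. *)
Lemma Lz_zb w : U w -> vdzb (Lz Ylift) w = wd db lamz w *: Gf w + lamb w *: Gz w
  + lamz w *: Gb w + (lam w * rho w) *: null_infty.
Proof.
move=> Uw; rewrite vdzb_wd (vwd_Lz _ Uw) (vwd_Gf _ Uw) (vwdb_Gz Uw).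
rewrite -[tlift (X w) _]/(Gb w) -/lamb.
move: (wd _ _ _) (lamz w) (lamb w) (lam w) (rho w) (Gf w) (Gz w) (Gb w).
by move=> a b c d e g gz gb; apply/rowP => j; rewrite !mxE; ring.
Qed.

Lemma lorentz_GG w : lorentz (Gf w) (Gf w) = 0. Proof. exact: lorentz_paraboloid. Qed.
Lemma lorentz_Gz w : lorentz (Gf w) (Gz w) = 0. Proof. exact:
  lorentz_paraboloid_tlift. Qed.
Lemma lorentz_Gb w : lorentz (Gf w) (Gb w) = 0. Proof. exact:
  lorentz_paraboloid_tlift. Qed.
Lemma lorentz_Gp w : lorentz (Gf w) null_infty = -1. Proof. exact:
  lorentz_paraboloid_null_infty. Qed.
Lemma lorentz_zG w : lorentz (Gz w) (Gf w) = 0. Proof. by rewrite lorentzC lorentz_Gz.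
Qed.
Lemma lorentz_zz w : U w -> lorentz (Gz w) (Gz w) = 0.
Proof. by move=> Uw; rewrite lorentz_tlift XzXz. Qed.
Lemma lorentz_zb w : lorentz (Gz w) (Gb w) = rho w. Proof. by rewrite lorentz_tlift.
Qed.
Lemma lorentz_zp w : lorentz (Gz w) null_infty = 0. Proof. exact:
  lorentz_tlift_null_infty. Qed.
Lemma lorentz_bb w : U w -> lorentz (Gb w) (Gb w) = 0.
Proof. by move=> Uw; rewrite lorentz_tlift XbXb. Qed.
Lemma lorentz_bp w : lorentz (Gb w) null_infty = 0. Proof. exact:
  lorentz_tlift_null_infty. Qed.
Lemma lorentz_pp : lorentz (null_infty : 'rV[C]_(n + 1 + 1)) null_infty = 0. Proof.
  exact: lorentz_null_infty. Qed.
Lemma lorentz_qG w : lorentz (Gzz w) (Gf w) = 0. Proof. by rewrite lorentzC; exact: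
  lorentz_paraboloid_tlift. Qed.
Lemma lorentz_qz w : U w -> lorentz (Gzz w) (Gz w) = 0.
Proof. by move=> Uw; rewrite lorentz_tlift XzzXz. Qed.
Lemma lorentz_qb w : U w -> lorentz (Gzz w) (Gb w) = wd dd rho w.
Proof. by move=> Uw; rewrite lorentz_tlift wd_rho_dot. Qed.
Lemma lorentz_qp w : lorentz (Gzz w) null_infty = 0. Proof. exact:
  lorentz_tlift_null_infty. Qed.
Lemma lorentz_qq w : U w -> lorentz (Gzz w) (Gzz w) = 0.
Proof. by move=> Uw; rewrite lorentz_tlift XzzXzz. Qed.

Lemma lorentz_canonical w : U w -> lorentz (Lz Ylift w) (Lzb Ylift w) = 2^-1.
Proof.
move=> Uw; rewrite (Lz_Ylift Uw) (Lzb_Ylift Uw).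
rewrite !(lorentzDl, lorentzDr, lorentzZl, lorentzZr) lorentz_GG lorentz_Gb lorentz_zG
  lorentz_zb (rho_lam Uw).
by have := lam_neq0 Uw; move: (lam w) (lamz w) (lamb w) => l z b l0; field.
Qed.

Local Opaque Gf Gz Gb Gzz Xz Xb Xzz lam lamz lamb rho null_infty comb4.

Definition frame w := comb4 (Gf w) (Gz w) (Gb w) null_infty.

Lemma vconj_frame w a b c d : U w ->
  vconj (frame w a b c d) = frame w a^*%C c^*%C b^*%C d^*%C.
Proof.
move=> Uw.
exact: vconj_comb4_swap (vconj_Gf w) (vconj_Gz Uw) (vconj_Gb Uw) (vconj_null_infty _ _).
Qed.

Lemma lorentz_frame w a b c d a' b' c' d' : U w ->
  lorentz (frame w a b c d) (frame w a' b' c' d') =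
  (b * c' + c * b') * rho w - (a * d' + d * a').
Proof.
move=> Uw; exact: lorentz_comb4 (lorentz_GG w) (lorentz_Gz w) (lorentz_Gb w)
  (lorentz_Gp w) (lorentz_zz Uw) (lorentz_zb w)
  (lorentz_zp w) (lorentz_bb Uw) (lorentz_bp w) lorentz_pp.
Qed.

Lemma Ylift_frame w : cplx (Ylift w) = frame w (lam w) 0 0 0.
Proof. exact: etrans (cplx_Ylift w) (esym (comb4_g _ _ _ _ _)). Qed.

Lemma Lz_frame w : U w -> Lz Ylift w = frame w (lamz w) (lam w) 0 0.
Proof. by move=> Uw; exact: etrans (Lz_Ylift Uw) (esym (comb4_gu _ _ _ _ _ _)). Qed.

Lemma Lzb_frame w : U w -> Lzb Ylift w = frame w (lamb w) 0 (lam w) 0.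
Proof. by move=> Uw; exact: etrans (Lzb_Ylift Uw) (esym (comb4_gv _ _ _ _ _ _)). Qed.

(** Expressed through G, G_z, G_zb and p, the generators of V form a triangular system with diagonal
    [lam], [lam], [lam], [lam * rho]. *)
Lemma frame_bundle w a b c d : U w -> (frame w a b c d <= cplx (Vbundle Ylift w))%MS.
Proof.
move=> Uw; set V := Vbundle Ylift w; have : (V <= V)%MS by exact: submx_refl.
rewrite {1}/V /Vbundle !addsmx_sub => /andP[/andP[/andP[VY VRe] VIm] VW].
have l0 := lam_neq0 Uw; have r0 := rho_neq0 Uw.
have {VY} := submx_cplx VY; rewrite Ylift_frame => VY.
have [] := submx_Re_Im VRe VIm; rewrite (Lz_frame Uw) (vconj_frame _ _ _ _ Uw) => Vz Vb.
have {VW} := submx_cplx VW.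
rewrite cplx_ReE (Lz_zb Uw) -comb4E -/(frame w _ _ _ _) (vconj_frame _ _ _ _ Uw).
rewrite /frame comb4D comb4Z -/(frame w _ _ _ _).
rewrite (conj_lamz Uw) (conj_lamb Uw) (conjcM (lam w)) conj_lam.
rewrite (_ : (rho w)^*%C = rho w); last by rewrite (rhoE Uw) conjc_real.
have half (y : C) : 2^-1 * (y + y) = y by field.
have lr0 : lam w * rho w != 0 by rewrite mulf_neq0.
(* The coefficient of [Gf] remains the average of a number and its conjugate; [span_comb4] accepts
   any value there. *)
rewrite !half => VW; rewrite conj_lam in Vb; rewrite conjc0 in Vb.
exact: (span_comb4 l0 l0 l0 lr0 VY Vz Vb VW).
Qed.

Lemma bundle_frame w (A : 'rV[C]_(n + 1 + 1)) : U w -> (A <= cplx (Vbundle Ylift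
  w))%MS ->
  exists a b c d, A = frame w a b c d.
Proof.
move=> Uw AV; apply: submx_comb4P.
have [WG Wz Wb Wp] := submx_adds4 (Gf w) (Gz w) (Gb w) null_infty.
set W := addsmx _ _ in WG Wz Wb Wp *.
have WF a b c d : (frame w a b c d <= W)%MS by exact: submx_comb4.
apply: (submx_trans AV); apply: cplx_adds4_sub.
- by rewrite Ylift_frame.
- rewrite cplx_ReE (Lz_frame Uw) (vconj_frame _ _ _ _ Uw) /frame comb4D comb4Z; exact:
  WF.
- rewrite cplx_ImE (Lz_frame Uw) (vconj_frame _ _ _ _ Uw) /frame comb4B comb4Z; exact:
  WF.
rewrite cplx_ReE (Lz_zb Uw) -comb4E -/(frame w _ _ _ _) (vconj_frame _ _ _ _ Uw).
rewrite /frame comb4D comb4Z; exact: WF.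
Qed.

Lemma perp_bundle w (A : 'rV[C]_(n + 1 + 1)) : U w ->
  lorentz A (Gf w) = 0 -> lorentz A (Gz w) = 0 -> lorentz A (Gb w) = 0 ->
  lorentz A null_infty = 0 -> (A <= cplx (Vperp Ylift w))%MS.
Proof.
move=> Uw AG Az Ab Ap; apply/cplx_kermx_lorentzP => B /(bundle_frame Uw)[a [b [c [d
  ->]]]].
exact: lorentz_comb4r0.
Qed.

(** Since [rho] is nonzero the form is nondegenerate on V: pairing with each frame vector isolates
    one coefficient. The trivial intersection is what makes the [proj_mx] of [Dzb] a projection onto
    V^perp along V. *)
Lemma bundle_cap w : U w -> (cplx (Vperp Ylift w) :&: cplx (Vbundle Ylift w) = 0)%MS.
Proof.
move=> Uw; have r0 := rho_neq0 Uw.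
apply/eqP; rewrite -submx0; apply/rV_subP => A; rewrite sub_capmx => /andP[].
move=> /cplx_kermx_lorentzP Aperp /(bundle_frame Uw)[a [b [c [d E]]]].
have F a' b' c' d' := Aperp _ (frame_bundle a' b' c' d' Uw).
have {F}F a' b' c' d' : (b * c' + c * b') * rho w - (a * d' + d * a') = 0.
  by rewrite -(lorentz_frame _ _ _ _ _ _ _ _ Uw) -E F.
have a0 : a = 0 by have := F 0 0 0 1; move=> /eqP; rewrite !(mulr0, mulr1, addr0,
  add0r, mul0r, oppr_eq0) => /eqP.
have d0 : d = 0 by have := F 1 0 0 0; move=> /eqP; rewrite !(mulr0, mulr1, addr0,
  add0r, mul0r, oppr_eq0) => /eqP.
have c0 : c = 0.
  have := F 0 1 0 0; move=> /eqP; rewrite !(mulr0, mulr1, addr0, add0r, mul0r, subr0)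
    mulf_eq0.
  by rewrite (negPf r0) orbF => /eqP.
have b0 : b = 0.
  have := F 0 0 1 0; move=> /eqP; rewrite !(mulr0, mulr1, addr0, add0r, mul0r, subr0)
    mulf_eq0.
  by rewrite (negPf r0) orbF => /eqP.
rewrite E a0 b0 c0 d0 /frame comb4_g scale0r; exact: sub0mx.
Qed.

(** Only the pairing with G_zb fails to vanish term by term. It is lam rho_z + 2 lam_z rho, and its
    vanishing is what fixes the coefficient 2 lam_z in [kappa]. *)
Lemma kappa_perp w : U w -> (kappa w <= cplx (Vperp Ylift w))%MS.
Proof.
move=> Uw; apply: (perp_bundle Uw).
- exact: lorentz_comb2_0 (lorentz_qG w) (lorentz_zG w).
- exact: lorentz_comb2_0 (lorentz_qz Uw) (lorentz_zz Uw).
- apply: (etrans (lorentz_comb2E _ _ (lorentz_qb Uw) (lorentz_zb w))); have :=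
  wd_rho_lam Uw.
  move: (lam w) (wd _ _ _) (rho w) (lamz w) => l r' r lz E; rewrite -E; ring.
- exact: lorentz_comb2_0 (lorentz_qp w) (lorentz_zp w).
Qed.

(** G_zz is null by super-conformality, and it is orthogonal to the null vector G_z by
    differentiating x_z . x_z = 0; hence all their combinations are null. *)
Lemma kappa_null w : U w -> lorentz (kappa w) (kappa w) = 0.
Proof. by move=> Uw; exact: lorentz_comb2_null (lorentz_qq Uw) (lorentz_qz Uw)
  (lorentz_zz Uw). Qed.

Lemma smooth_kappa : vsmooth U kappa.
Proof.
apply: vsmoothD => //; apply: vsmoothZ => //; [exact: smooth_lam|exact: smooth_Gzz|
  |exact: smooth_Gz].
by apply: csmoothM => //; [exact: csmooth_cst|exact: smooth_lamz].
Qed.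

(** The derivatives of [Gzz] and [Gz] both point along [null_infty], and their contributions cancel
    by [wd_rho_lam]. What remains beside [kappa] lies in V. *)
Lemma vwd_kappa w : U w -> vwd db kappa w = (lamb w / lam w) *: kappa w
  + (2 * wd db lamz w - 2 * lamb w * lamz w / lam w) *: Gz w.
Proof.
move=> Uw; have l0 := lam_neq0 Uw.
have dq := vsmooth_diff smooth_Gzz Uw; have dz := vsmooth_diff smooth_Gz Uw.
apply: (etrans (vwd_comb2 (cdiff_lam Uw) dq (cdiffM (cdiff_cst 2 w) (cdiff_lamz Uw)) dz
  (erefl (lamb w)) (vwdb_Gzz Uw) (wd_Zl db 2 (cdiff_lamz Uw)) (vwdb_Gz Uw))).
rewrite /kappa; have := wd_rho_lam Uw.
move: (wd dd rho w) (rho w) (lam w) (lamb w) (lamz w) (wd db lamz w) l0 => rz r l lb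
  lz e l0.
move: (Gzz w) (Gz w) (null_infty : 'rV[C]_(n + 1 + 1)) => q z p E.
have -> : l *: (rz *: p) = - (2 * r * lz) *: p.
  by rewrite scalerA; congr (_ *: _); apply/eqP; rewrite -subr_eq0 opprK E.
by apply/rowP => j; rewrite !mxE; field.
Qed.

(** The projection fixes [kappa], which is in V^perp, and annihilates [Gz], which is in V. *)
Lemma Dzb_kappa_part w (F : R * R -> 'rV[C]_(n + 1 + 1)) (c b : C) : U w ->
  vwd db F w = c *: kappa w + b *: Gz w -> Dzb Ylift F w = c *: kappa w.
Proof.
move=> Uw E; rewrite /Dzb vdzb_wd E mulmxDl.
rewrite (proj_mx_id (bundle_cap Uw)); last by apply: scalemx_sub; exact: kappa_perp.
rewrite (proj_mx_0 (bundle_cap Uw)); first exact: addr0.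
by have := frame_bundle 0 b 0 0 Uw; rewrite /frame comb4_gu scale0r add0r.
Qed.

Lemma Dzb_kappa w : U w -> Dzb Ylift kappa w = (lamb w / lam w) *: kappa w.
Proof. by move=> Uw; exact: Dzb_kappa_part Uw (vwd_kappa Uw). Qed.

Lemma smooth_lamV : csmooth U (fun w => (lam w)^-1).
Proof. apply: csmoothV => //; [exact: lam_neq0|exact: smooth_lam]. Qed.

Lemma near_lam_neq0 w : U w -> \forall u \near w, lam u != 0.
Proof. by move=> Uw; apply: filterS (open_nbhs_nbhs (conj oU Uw)) => u; exact:
  lam_neq0. Qed.

Lemma wd_quot t (f : R * R -> C) w f' l' : U w -> cdiff f w ->
  wd t f w = f' -> wd t lam w = l' ->
  wd t (fun u => f u / lam u) w = f' / lam w - f w * l' / lam w ^+ 2.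
Proof.
move=> Uw df fE lE.
exact: wd_div df (cdiff_lam Uw) (csmooth_diff smooth_lamV Uw) (near_lam_neq0 Uw) fE lE.
Qed.

(** With h = lam_zb / lam the coefficient is h_zb + h^2, in which the squares of lam_zb cancel. *)
Lemma Dzb_Dzb_kappa w : U w -> Dzb Ylift (Dzb Ylift kappa) w = (wd db lamb w / lam w)
  *: kappa w.
Proof.
move=> Uw; have l0 := lam_neq0 Uw.
apply: (@Dzb_kappa_part _ _ _ ((lamb w / lam w)
  * (2 * wd db lamz w - 2 * lamb w * lamz w / lam w)) Uw).
rewrite (@vwd_eq_on _ _ U _ _ (fun u => (lamb u / lam u) *: kappa u) w oU Uw Dzb_kappa).
have dlb := cdiff_lamb Uw.
have dh : cdiff (fun u => lamb u / lam u) w.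
  by apply: cdiffM => //; exact: csmooth_diff smooth_lamV Uw.
have qE := wd_quot Uw dlb (erefl (wd db lamb w)) (erefl (lamb w)).
apply: (etrans (vwdZE dh (vsmooth_diff smooth_kappa Uw) qE (vwd_kappa Uw))).
move: (lam w) (lamb w) (lamz w) (wd db lamz w) (wd db lamb w) (kappa w) (Gz w) l0.
by move=> l lb lz e f k z l0; apply/rowP => j; rewrite !mxE; field.
Qed.

Lemma frame_willmore w : U w ->
  Dzb Ylift (Dzb Ylift kappa) w + ((schwarzian w)^*%C / 2) *: kappa w = 0.
Proof.
move=> Uw; rewrite (Dzb_Dzb_kappa Uw) -scalerDl.
have -> : (schwarzian w)^*%C = - 2 * wd db lamb w / lam w.
  by rewrite /schwarzian conjcM conjc_inv conj_lam conjcM (conj_lamzz Uw) conjcN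
    conjc_nat.
have := lam_neq0 Uw; move: (lam w) (wd _ _ _) => l e l0.
by rewrite (_ : _ + _ = 0) ?scale0r //; field.
Qed.

(** The coefficients are forced by the conditions on N: the product with Y gives the last one, those
    with Y_z and Y_zb the middle two, and nullity the first. *)
Definition Ncplx w := frame w (2 * lamz w * lamb w / lam w) (2 * lamb w) (2 * lamz w)
  (lam w)^-1.
Definition Nlift w : 'rV[R]_(n + 1 + 1) := map_mx (@complex.Re R) (Ncplx w).

Lemma cplx_Nlift w : U w -> cplx (Nlift w) = Ncplx w.
Proof.
move=> Uw; apply: cplx_Re; rewrite (vconj_frame _ _ _ _ Uw) /Ncplx.
by have [-> -> -> ->] := conjc_N_coefs (conj_lam w) (conj_lamz Uw) (conj_lamb Uw).
Qed.

Lemma Nlift_bundle w : U w -> (Nlift w <= Vbundle Ylift w)%MS.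
Proof.
move=> Uw; rewrite -(map_submx (real_complex R)) -/(cplx (Nlift w)) (cplx_Nlift Uw).
exact: frame_bundle.
Qed.

Lemma Nlift_null w : U w -> lorentz (cplx (Nlift w)) (cplx (Nlift w)) = 0.
Proof.
move=> Uw; rewrite (cplx_Nlift Uw) (lorentz_frame _ _ _ _ _ _ _ _ Uw) (rho_lam Uw).
by have := lam_neq0 Uw; move: (lam w) (lamz w) (lamb w) => l z b l0; field.
Qed.

Lemma Nlift_Ylift w : U w -> lorentz (cplx (Nlift w)) (cplx (Ylift w)) = -1.
Proof.
move=> Uw; rewrite (cplx_Nlift Uw) Ylift_frame (lorentz_frame _ _ _ _ _ _ _ _ Uw).
by have := lam_neq0 Uw; move: (lam w) (lamz w) (lamb w) (rho w) => l z b r l0; field.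
Qed.

Lemma Nlift_Lz w : U w -> lorentz (cplx (Nlift w)) (Lz Ylift w) = 0.
Proof.
move=> Uw; rewrite (cplx_Nlift Uw) (Lz_frame Uw) (lorentz_frame _ _ _ _ _ _ _ _ Uw).
rewrite (rho_lam Uw).
by have := lam_neq0 Uw; move: (lam w) (lamz w) (lamb w) => l z b l0; field.
Qed.

Lemma smooth_schwarzian : csmooth U schwarzian.
Proof.
apply: csmoothM => //; last exact: smooth_lamV.
by apply: csmoothM => //; [exact: csmooth_cst|apply: csmooth_wd => //; exact:
  smooth_lamz].
Qed.

Lemma smooth_Nlift : vsmooth U (fun w => cplx (Nlift w)).
Proof.
have s2 := csmooth_cst U (2 : C).
apply: (@vsmooth_eq _ _ oU _ Ncplx) => [w Uw|]; first by rewrite (cplx_Nlift Uw).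
apply: vsmooth_comb4 => //; [exact: smooth_Gf|exact: smooth_Gz|exact: smooth_Gb|exact:
  vsmooth_cst|..].
- apply: csmoothM => //; last exact: smooth_lamV.
  apply: csmoothM => //; last exact: smooth_lamb.
  by apply: csmoothM => //; exact: smooth_lamz.
- by apply: csmoothM => //; exact: smooth_lamb.
- by apply: csmoothM => //; exact: smooth_lamz.
- exact: smooth_lamV.
Qed.

(** * The foot of the perpendicular and the function mu *)

Variable x0 : 'rV[R]_n.
Definition from_pedal_point w := X w - cplx x0.
Definition foot_coef w := dot (from_pedal_point w) (Xb w).
(* [foot_coef] vanishes where the foot of the perpendicular is [x] itself; there
   [adjoint_mu] has a pole, and the division returns a junk value. *)
Definition adjoint_mu w := - 2 * rho w / foot_coef w + - 2 * lamz w / lam w.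
Definition foot w := X w - (foot_coef w / rho w) *: Xz w
  - (dot (from_pedal_point w) (Xz w) / rho w) *: Xb w.

Lemma smooth_from_pedal_point : vsmooth U from_pedal_point.
Proof. by apply: vsmoothD => //; exact: vsmooth_cst. Qed.

Lemma smooth_foot_coef : csmooth U foot_coef.
Proof.
by apply: csmooth_dot => //; [exact: smooth_from_pedal_point|exact: smooth_Xb].
Qed.

Lemma vconj_from_pedal_point w : vconj (from_pedal_point w) = from_pedal_point w.
Proof. by rewrite /from_pedal_point vconjD vconjN vconjX vconj_cplx. Qed.

Lemma conj_foot_coef w : U w -> (foot_coef w)^*%C = dot (from_pedal_point w) (Xz w).
Proof. by move=> Uw; rewrite /foot_coef conjc_dot vconj_from_pedal_point (vconj_Xb
  Uw). Qed.

Lemma vwd_from_pedal_point t w : U w -> vwd t from_pedal_point w = vwd t X w.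
Proof.
move=> Uw; apply: (etrans (vwdD t (vdiff_X Uw) (vdiff_cst w (- cplx x0)))).
by rewrite vwd_cst addr0.
Qed.

(** Minimality gives x_{zb z} = 0, so only the factor [x - x0] is differentiated, and the constant
    [x0] drops out: the identity is the same for every pedal point. *)
Lemma wd_foot_coef w : U w -> wd dd foot_coef w = rho w.
Proof.
move=> Uw; have dX : vdiff from_pedal_point w by exact: vsmooth_diff
  smooth_from_pedal_point Uw.
apply: (etrans (wd_dot dd dX (vdiff_Xb Uw))).
by rewrite (vwd_from_pedal_point _ Uw) (vwd_Xb Uw) dot0r addr0.
Qed.

Lemma smooth_foot : vsmooth U foot.
Proof.
have srV : csmooth U (fun w => (rho w)^-1).
  by apply: csmoothV => //; [exact: rho_neq0|exact: smooth_rho].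
apply: vsmoothD => //; first apply: vsmoothD => //.
  apply: vsmoothN => //; apply: vsmoothZ => //; last exact: smooth_Xz.
  by apply: csmoothM => //; exact: smooth_foot_coef.
apply: vsmoothN => //; apply: vsmoothZ => //; last exact: smooth_Xb.
apply: csmoothM => //; apply: csmooth_dot => //; [exact:
  smooth_from_pedal_point|exact: smooth_Xz].
Qed.

Lemma vconj_foot w : U w -> vconj (foot w) = foot w.
Proof.
move=> Uw; rewrite /foot -(conj_foot_coef Uw).
exact: vconj_pedal (vconjX w) (vconj_Xz Uw) (vconj_Xb Uw) (conj_rho Uw).
Qed.

Lemma paraboloid_foot w : U w -> paraboloid (foot w) = frame w 1 (- (foot_coef w / rho
  w))
  (- ((foot_coef w)^*%C / rho w)) (foot_coef w * (foot_coef w)^*%C / rho w).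
Proof.
move=> Uw; rewrite /foot -(conj_foot_coef Uw).
exact: paraboloid_pedal_step (rho_neq0 Uw) (XzXz Uw) (XbXb Uw) (erefl _).
Qed.

Variable W : set (R * R).
Hypotheses (oW : open W) (WU : W `<=` U) (foot_coef_neq0 : forall w, W w -> foot_coef
  w != 0).

Lemma smooth_foot_coefV : csmooth W (fun w => (foot_coef w)^-1).
Proof. by apply: csmoothV => //; exact: csmooth_sub WU smooth_foot_coef. Qed.

Lemma smooth_adjoint_mu : csmooth W adjoint_mu.
Proof.
have s2 := csmooth_cst W (- 2 : C).
apply: csmoothD => //; apply: csmoothM => //.
- by apply: csmoothM => //; exact: csmooth_sub WU smooth_rho.
- exact: smooth_foot_coefV.
- by apply: csmoothM => //; exact: csmooth_sub WU smooth_lamz.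
- exact: csmooth_sub WU smooth_lamV.
Qed.

(** The summand -2 lam_z / lam solves the equation by itself. For nu = -2 rho / g, the identity g_z
    = rho cancels nu^2 / 2 against part of nu_z; the remainder -2 rho_z / g cancels the cross term
    of the square by [wd_rho_lam]. *)
Lemma riccati w : W w -> dz adjoint_mu w - 2^-1 * (adjoint_mu w) ^+ 2 - schwarzian w =
  0.
Proof.
move=> Ww; have Uw := WU Ww; have l0 := lam_neq0 Uw; have g0 := foot_coef_neq0 Ww.
have d2 := cdiff_cst (- 2 : C) w; have dr := csmooth_diff smooth_rho Uw; have dlz :=
  cdiff_lamz Uw.
have dg := csmooth_diff smooth_foot_coef Uw; have dgV := csmooth_diff
  smooth_foot_coefV Ww.
have ng : \forall u \near w, foot_coef u != 0.
  by apply: filterS (open_nbhs_nbhs (conj oW Ww)) => u; exact: foot_coef_neq0.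
have E1 := wd_div (cdiffM d2 dr) dg dgV ng (wd_Zl dd (- 2) dr) (wd_foot_coef Uw).
have E2 := wd_quot Uw (cdiffM d2 dlz) (wd_Zl dd (- 2) dlz) (erefl (lamz w)).
have D1 : cdiff (fun u => - 2 * rho u / foot_coef u) w by apply: cdiffM => //; exact:
  cdiffM.
have D2 : cdiff (fun u => - 2 * lamz u / lam u) w.
  by apply: cdiffM; [exact: cdiffM|exact: csmooth_diff smooth_lamV Uw].
rewrite dz_wd (_ : wd dd adjoint_mu w = wd dd (fun u => - 2 * rho u / foot_coef u) w
  + wd dd (fun u => - 2 * lamz u / lam u) w); last exact: wdD.
rewrite E1 E2 /adjoint_mu /schwarzian; have := wd_rho_lam Uw.
move: (wd dd rho w) (rho w) (foot_coef w) (lam w) (lamz w) (wd dd lamz w) g0 l0.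
move=> rz r g l lz dlz' g0 l0 E.
have -> : rz = - (2 * r * lz) / l.
  by apply: (mulfI l0); rewrite mulrCA divff // mulr1; apply/eqP; rewrite -subr_eq0
    opprK E.
by field; rewrite l0 g0.
Qed.

Lemma eta_null w : W w ->
  let eta := Dzb Ylift kappa w + ((adjoint_mu w)^*%C / 2) *: kappa w in lorentz eta
    eta = 0.
Proof.
move=> /WU Uw; rewrite /= (Dzb_kappa Uw) -scalerDl lorentzZl lorentzZr (kappa_null Uw).
by rewrite !mulr0.
Qed.

Lemma adjoint_paraboloid w : W w -> exists2 k : R, k != 0 &
  (2^-1 * (adjoint_mu w * (adjoint_mu w)^*%C)) *: cplx (Ylift w) + (adjoint_mu w)^*%C
    *: Lz Ylift w
    + adjoint_mu w *: Lzb Ylift w + cplx (Nlift w) = k%:C *: paraboloid (foot w).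
Proof.
move=> Ww; have Uw := WU Ww; have l0 := lam_neq0 Uw; have g0 := foot_coef_neq0 Ww.
have gc0 : (foot_coef w)^*%C != 0 by rewrite conjc_eq0.
(* This is lam |nu|^2 / 2 for nu = -2 rho / g, the coefficient of [Gf] in Yhat, with [rho]
   eliminated by [rho_lam]. *)
pose k := 2^-1 * (lam w)^-1 ^+ 3 * (foot_coef w * (foot_coef w)^*%C)^-1.
have kc : k^*%C = k by exact: conjc_factor (conj_lam w).
have kE : k = (complex.Re k)%:C.
  by move: kc; case: (k) => a b [] /= bN; apply: complexP => //=; lra.
exists (complex.Re k).
  rewrite -(inj_eq (@complexI R)) -kE /k.
  by rewrite !mulf_neq0 ?invr_eq0 ?expf_neq0 ?mulf_neq0 ?invr_eq0 // pnatr_eq0.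
rewrite -kE (cplx_Nlift Uw) Ylift_frame (Lz_frame Uw) (Lzb_frame Uw) (paraboloid_foot
  Uw).
rewrite (_ : (adjoint_mu w)^*%C = - 2 * rho w / (foot_coef w)^*%C + - 2 * lamb w / lam
  w); last first.
  exact: conjc_mu (conj_rho Uw) (conj_lam w) (conj_lamz Uw).
rewrite /Ncplx /frame !comb4Z !comb4D /adjoint_mu /k (rho_lam Uw).
move: (lam w) (lamz w) (lamb w) (foot_coef w) ((foot_coef w)^*%C) l0 g0 gc0.
move=> l lz lb g gc l0 g0 gc0.
by congr comb4; field; rewrite ?l0 ?g0 ?gc0.
Qed.

End Frame.

(** * The stereographic projection *)

Section Stereographic.
Variable R : realType.
Local Notation C := R[i].

Lemma sqnorm_ge0 n (y : 'rV[R]_n) : 0 <= sqnorm y.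
Proof. by rewrite /sqnorm mxE sumr_ge0 // => j _; rewrite mxE -expr2 sqr_ge0. Qed.

Lemma sqnorm1_gt0 n (y : 'rV[R]_n) : 0 < 1 + sqnorm y.
Proof. by have := sqnorm_ge0 y; lra. Qed.

Lemma istereoE n (y : 'rV[R]_n) :
  istereo y = (1 + sqnorm y)^-1 *: row_mx (2 *: y) (sqnorm y - 1)%:M.
Proof. by []. Qed.

Lemma sphere_istereo n (y : 'rV[R]_n) : sphere (istereo y).
Proof.
rewrite /sphere istereoE; set q := sqnorm y.
have q0 : 1 + q != 0 by rewrite gt_eqF // sqnorm1_gt0.
rewrite linearZ /= -scalemxAl -scalemxAr scalerA tr_row_mx mul_row_col.
rewrite tr_scalar_mx -scalar_mxM linearZ /= -scalemxAl -scalemxAr scalerA.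
rewrite mxE [X in _ * X]mxE [X in _ * (X + _)]mxE [X in _ * (_ + X)]mxE eqxx mulr1n.
by rewrite -/(sqnorm y) -/q; field.
Qed.

(** The factor normalizes the last coordinate to 1. *)
Lemma cone_istereo n (y : 'rV[R]_n) : cone (istereo y) =
  (2 / (1 + sqnorm y)) *: mrow y ((sqnorm y - 1) / 2) ((sqnorm y + 1) / 2).
Proof.
have q0 : 1 + sqnorm y != 0 by rewrite gt_eqF // sqnorm1_gt0.
rewrite /cone istereoE /mrow !scale_row_mx !scale_scalar_mx scalerA.
congr (row_mx (row_mx (_ *: _) _%:M) _%:M); field; exact: q0.
Qed.

Lemma cplx_paraboloid n (y : 'rV[R]_n) :
  cplx (mrow y ((sqnorm y - 1) / 2) ((sqnorm y + 1) / 2)) = paraboloid (cplx y).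
Proof.
have E1 (a : R) : ((a - 1) / 2)%:C = (a%:C - 1) / 2 :> C.
  by rewrite rmorphM rmorphB fmorphV rmorph_nat rmorph1.
have E2 (a : R) : ((a + 1) / 2)%:C = (a%:C + 1) / 2 :> C.
  by rewrite rmorphM rmorphD fmorphV rmorph_nat rmorph1.
by rewrite cplx_mrow /paraboloid cplx_dot E1 E2.
Qed.

Lemma cplxZ m (k : R) (y : 'rV[R]_m) : cplx (k *: y) = k%:C *: cplx y.
Proof. by rewrite /cplx map_mxZ. Qed.

Lemma cplx_cone n (y : 'rV[R]_n) :
  cplx (cone (istereo y)) = (2 / (1 + sqnorm y))%:C *: paraboloid (cplx y).
Proof. by rewrite cone_istereo cplxZ cplx_paraboloid. Qed.

Lemma paraboloid_cone n (y : 'rV[R]_n) (k : R) : k != 0 -> exists2 r : R, r != 0 &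
  k%:C *: paraboloid (cplx y) = cplx (r *: cone (istereo y)).
Proof.
move=> k0; have q0 : 1 + sqnorm y != 0 by rewrite gt_eqF // sqnorm1_gt0.
exists (k * (1 + sqnorm y) / 2); first by rewrite !mulf_neq0 // invr_eq0 pnatr_eq0.
rewrite cplxZ cplx_cone scalerA -rmorphM; congr (_%:C *: _).
by field; exact: q0.
Qed.

Section SmoothStereo.
Variables (U : set (R * R)) (oU : open U) (n : nat) (f : R * R -> 'rV[R]_n).
Hypothesis sf : vsmooth U (ambient f).

(** The conformal factor of inverse stereographic projection, as [dot_vwd_stereo] confirms. *)
Definition stereo_factor w : R := 2 / (1 + sqnorm (f w)).

Lemma stereo_factor_gt0 w : 0 < stereo_factor w.
Proof. by rewrite divr_gt0 // sqnorm1_gt0. Qed.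

Lemma smooth_stereo_factor : csmooth U (fun w => (stereo_factor w)%:C).
Proof.
apply: csmooth_real; apply: smoothM => //; first exact: smooth_cst.
apply: smoothV => // [w _|]; first by rewrite gt_eqF // sqnorm1_gt0.
apply: smoothD => //; first exact: smooth_cst.
have [sq _] := csmooth_dot oU sf sf.
by apply: smooth_eq sq => // w _; rewrite cplx_dot.
Qed.

Definition stereo w : 'rV[C]_(n + 1) := cplx (istereo (f w)).

Lemma cplx_cone_row w : cplx (cone (istereo (f w))) = row_mx (stereo w) 1%:M.
Proof. by rewrite /cplx /cone map_row_mx map_scalar_mx rmorph1. Qed.

Lemma stereo_row w : row_mx (stereo w) 1%:M = (stereo_factor w)%:C *: paraboloid
  (ambient f w).
Proof. by rewrite -cplx_cone_row cplx_cone. Qed.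

Lemma smooth_stereo : vsmooth U stereo.
Proof.
have sG := vsmoothZ oU smooth_stereo_factor (vsmooth_paraboloid oU sf).
move=> j; apply: csmooth_eq (sG (lshift 1 j)) => // w _.
by rewrite -stereo_row row_mxEl.
Qed.

Lemma vwd_stereo t w : U w -> row_mx (vwd t stereo w) 0%:M =
  wd t (fun w => (stereo_factor w)%:C) w *: paraboloid (ambient f w)
  + (stereo_factor w)%:C *: tlift (ambient f w) (vwd t (ambient f) w).
Proof.
move=> Uw; rewrite -(wd_cst t (1 : C) w) -(vwd_row_mx t w stereo (fun=> 1)).
have df := vsmooth_diff sf Uw; have ds := csmooth_diff smooth_stereo_factor Uw.
rewrite -(vwd_paraboloid t df) -(vwdZ t ds (vdiff_paraboloid df)).
by congr (vwd t _ w); apply/funext => u; exact: stereo_row.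
Qed.

(** The appended coordinate of the cone is constant, so the Euclidean product of derivatives equals
    their Lorentz product. There the terms along [paraboloid] drop out, since it is null and
    orthogonal to its tangent vectors. *)
Lemma dot_vwd_stereo s t w : U w -> dot (vwd s stereo w) (vwd t stereo w) =
  (stereo_factor w)%:C ^+ 2 * dot (vwd s (ambient f) w) (vwd t (ambient f) w).
Proof.
move=> Uw; have := lorentz_row_mx (vwd s stereo w) (vwd t stereo w) 0 0.
rewrite mulr0 subr0 => <-; rewrite !(vwd_stereo _ Uw).
move: (wd _ _ w) (wd _ _ w) (_%:C) (ambient f w) (vwd _ _ w) (vwd _ _ w).
move=> a b k p u v.
rewrite !(lorentzDl, lorentzDr, lorentzZl, lorentzZr) lorentz_paraboloid
  lorentz_paraboloid_tlift.
by rewrite (lorentzC (tlift _ _)) lorentz_paraboloid_tlift lorentz_tlift; ring.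
Qed.

End SmoothStereo.
End Stereographic.

Section NearNonzero.
Variable R : realType.

Lemma csmooth_near_neq0 (U : set (R * R)) (f : R * R -> R[i]) w : csmooth U f -> U w ->
  f w != 0 -> \forall u \near w, f u != 0.
Proof.
move=> [f1 f2] Uw; rewrite eq_complex /= negb_and => /orP[] f0.
  have c1 : complex.Re (f u) @[u --> w] --> complex.Re (f w) by exact: (f1 0%N).
  have n1 : \forall u \near w, complex.Re (f u) != 0 by exact: cvgr_neq0 _ c1 f0.
  by apply: filterS n1 => u; apply: contra => /eqP ->.
have c2 : complex.Im (f u) @[u --> w] --> complex.Im (f w) by exact: (f2 0%N).
have n2 : \forall u \near w, complex.Im (f u) != 0 by exact: cvgr_neq0 _ c2 f0.
by apply: filterS n2 => u; apply: contra => /eqP ->.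
Qed.

End NearNonzero.

(** * Surfaces *)

Section Surface.
Variables (R : realType) (M : riemann_surface R) (n : nat) (x : M -> 'rV[R]_n).
Hypothesis hx : superconformal_minimal x.
Local Notation C := R[i].
Local Notation dd := (- 'i%C : C).
Local Notation db := ('i%C : C).
Implicit Types (c : chart R M).

Definition chart_map c : R * R -> 'rV[R]_n := fun w => x (cinv c w).

Lemma zdom_open c : open (zdom c).
Proof. by rewrite /zdom /coord_image setIT; exact: cimg_open. Qed.

Lemma zdomP c p : cdom c p -> zdom c (cmap c p).
Proof. by move=> cp; exists p. Qed.

Lemma zdom_cinv c w : zdom c w -> cdom c (cinv c w) /\ cmap c (cinv c w) = w.
Proof. by move=> [p [cp _] <-]; rewrite cmapK. Qed.

Lemma cinv_cont c w : zdom c w -> {for w, continuous (cinv c)}.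
Proof. by rewrite /zdom /coord_image setIT; exact: cinv_continuous. Qed.

Lemma chart_smooth c : atlas c -> vsmooth (zdom c) (ambient (chart_map c)).
Proof. by move: hx => [[[sx _] _] _] /sx. Qed.

Lemma chart_XzXz c : atlas c -> forall w, zdom c w ->
  dot (Xz (chart_map c) w) (Xz (chart_map c) w) = 0.
Proof. by move: hx => [[[_ h] _] _] /h {}h w /h; rewrite vdz_wd => -[]. Qed.

Lemma chart_rho c : atlas c -> forall w, zdom c w -> 0 < rho (chart_map c) w.
Proof. by move: hx => [[[_ h] _] _] /h {}h w /h; rewrite vdz_wd => -[]. Qed.

Lemma chart_XzXb c : atlas c -> forall w, zdom c w -> vwd db (Xz (chart_map c)) w = 0.
Proof. by move: hx => [[_ h] _] /h {}h w /h; rewrite vdz_wd. Qed.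

Lemma chart_XzzXzz c : atlas c -> forall w, zdom c w ->
  dot (Xzz (chart_map c) w) (Xzz (chart_map c) w) = 0.
Proof. by move: hx => [_ h] /h {}h w /h; rewrite vdz_wd. Qed.

Lemma near_cinv c w (A : set M) : zdom c w -> open A -> A (cinv c w) ->
  \forall u \near w, A (cinv c u).
Proof.
by move=> zw oA Aw; apply: (cinv_cont zw); exact: open_nbhs_nbhs.
Qed.

Lemma near_zdom c w : zdom c w -> \forall u \near w, zdom c u.
Proof. move=> zw; have zn : open_nbhs w (zdom c) by split=> //; exact: zdom_open.
exact: (open_nbhs_nbhs zn). Qed.

(** The factor is the derivative of the holomorphic transition map. The two local expressions agree
    only where both charts are defined, hence the passage through a neighbourhood of [w]. *)
Lemma chart_change c c' w : atlas c -> atlas c' -> zdom c w -> cdom c' (cinv c w) ->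
  exists tau : C,
    Xz (chart_map c) w = tau *: Xz (chart_map c') (cmap c' (cinv c w)) /\
    Xb (chart_map c) w = tau^*%C *: Xb (chart_map c') (cmap c' (cinv c w)).
Proof.
move=> ac ac' zw c'w; set w' := cmap c' (cinv c w).
pose T u := cmap c' (cinv c u).
have cw : coord_image c (cdom c') w by exists (cinv c w); have [] := zdom_cinv zw.
have [dT CR] := atlas_holomorphic ac ac' cw.
have [tau tauP] := wirtinger_chain dT CR.
have dX : vdiff (ambient (chart_map c')) w'.
  by apply: vsmooth_diff (chart_smooth ac') _; exact: zdomP.
have nE : {near w, ambient (chart_map c) =1 (fun u => ambient (chart_map c') (T u))}.
  have := near_cinv zw (cdom_open c') c'w; apply: filterS => u c'u.
  by rewrite /ambient /chart_map /T cmapK.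
exists tau; split.
  apply: (etrans (near_eq_vwd dd nE)); apply/rowP => j; rewrite !mxE -!dzE.
  by have [] := tauP _ (dX j).
apply: (etrans (near_eq_vwd db nE)); apply/rowP => j; rewrite !mxE -!dzbE.
by have [] := tauP _ (dX j).
Qed.

(** * The pedal surface in arbitrary charts *)

Variable x0 : 'rV[R]_n.

Lemma pedal_exprE c w : pedal_expr x x0 c w = foot (chart_map c) x0 w.
Proof. by rewrite /pedal_expr vdz_wd vdzb_wd. Qed.

(** The pedal formula is homogeneous of degree zero in each tangent vector separately, and a change
    of coordinate only rescales the two vectors. *)
Lemma pedal_step (X d u v : 'rV[C]_n) (t s : C) : t != 0 -> s != 0 -> dot u v != 0 ->
  X - (dot d (s *: v) / dot (t *: u) (s *: v)) *: (t *: u)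
    - (dot d (t *: u) / dot (t *: u) (s *: v)) *: (s *: v) =
  X - (dot d v / dot u v) *: u - (dot d u / dot u v) *: v.
Proof.
move=> t0 s0 r0; rewrite !(dotZl, dotZr) !scalerA.
move: (dot u v) (dot d v) (dot d u) r0 => r a b r0.
by congr (_ - _ *: _ - _ *: _); field; rewrite t0 s0 r0.
Qed.

(** A zero factor would make [rho] vanish, against the immersion condition. *)
Lemma chart_change_neq0 c c' w (tau : C) : atlas c -> zdom c w ->
  Xz (chart_map c) w = tau *: Xz (chart_map c') (cmap c' (cinv c w)) ->
  tau != 0.
Proof.
move=> ac zw E; apply/eqP => t0; have := rho_neq0 (chart_rho ac) zw.
by rewrite /rho E t0 scale0r dot0l eqxx.
Qed.

(** Frees [pedal] from the chart chosen at each point: over all of [c] it is given by one formula,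
    from which its smoothness follows. *)
Lemma pedal_chart c w : atlas c -> zdom c w ->
  cplx (pedal x x0 (cinv c w)) = foot (chart_map c) x0 w.
Proof.
move=> ac zw; rewrite /pedal; set c' := chart_at (cinv c w).
have [ac' c'w] : atlas c' /\ cdom c' (cinv c w) by exact: svalP (cid (atlas_cover _)).
rewrite pedal_exprE; set w' := cmap c' (cinv c w).
have zw' : zdom c' w' by exact: zdomP.
rewrite (cplx_Re (vconj_foot (@zdom_open c') (chart_smooth ac') (chart_rho ac') x0
  zw')).
have [tau [Ez Eb]] := chart_change ac ac' zw c'w.
have t0 := chart_change_neq0 ac zw Ez.
have XE : ambient (chart_map c) w = ambient (chart_map c') w'.
  by rewrite /ambient /chart_map /w' cmapK.
have tc0 : tau^*%C != 0 by rewrite conjc_eq0.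
rewrite /foot /foot_coef /rho /from_pedal_point Ez Eb XE.
exact: esym (pedal_step _ _ t0 tc0 (rho_neq0 (chart_rho ac') zw')).
Qed.

(** The points where mu has no pole. One chart suffices in the definition because [foot_coef]
    changes by a nonzero factor between charts, as [foot_coef_chart_neq0] shows. *)
Definition pedal_regular : set M :=
  [set p | exists c, [/\ atlas c, cdom c p & foot_coef (chart_map c) x0 (cmap c p) !=
    0]].

Lemma foot_coef_chart_neq0 c w : atlas c -> zdom c w -> pedal_regular (cinv c w) ->
  foot_coef (chart_map c) x0 w != 0.
Proof.
move=> ac zw [c' [ac' c'w g0]].
have [tau [Ez Eb]] := chart_change ac ac' zw c'w.
have t0 := chart_change_neq0 ac zw Ez.
have XE : ambient (chart_map c) w = ambient (chart_map c') (cmap c' (cinv c w)).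
  by rewrite /ambient /chart_map cmapK.
rewrite /foot_coef /from_pedal_point Eb XE dotZr mulf_neq0 // conjc_eq0 //.
Qed.

Lemma open_pedal_regular : open pedal_regular.
Proof.
rewrite openE => p [c [ac cp g0]]; rewrite /interior.
have zp := zdomP cp.
have sg := smooth_foot_coef (@zdom_open c) (chart_smooth ac) x0.
have ng := csmooth_near_neq0 sg zp g0.
have nq : \forall q \near p, foot_coef (chart_map c) x0 (cmap c q) != 0.
  by have cc : cmap c @ p --> cmap c p := cmap_continuous cp; exact: cc _ ng.
have nc : \forall q \near p, cdom c q.
  by apply: filterS (open_nbhs_nbhs (conj (@cdom_open _ _ c) cp)) => q.
by apply: filterS2 nq nc => q gq cq; exists c.
Qed.

Lemma dense_pedal_regular : dense pedal_regular.
Proof.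
move=> O [p Op] oO; apply: contrapT => nO.
have [c [ac cp]] := atlas_cover p.
have zp := zdomP cp; have Kp := cmapK cp.
have nO' : \forall u \near cmap c p, foot_coef (chart_map c) x0 u = 0.
  have nOu : \forall u \near cmap c p, O (cinv c u) by apply: near_cinv; rewrite ?Kp.
  apply: filterS2 nOu (near_zdom zp) => u Ou zu; apply: contrapT => /eqP g0.
  have [cu Ku] := zdom_cinv zu.
  by apply: nO; exists (cinv c u); split=> //; exists c; rewrite Ku.
have := rho_neq0 (chart_rho ac) zp.
rewrite -(wd_foot_coef (@zdom_open c) (chart_smooth ac) (chart_XzXb ac) x0 zp).
by rewrite (near_eq_wd dd (g := fun=> 0) nO') wd_cst eqxx.
Qed.

Lemma coord_regularP c w : coord_image c pedal_regular w ->
  zdom c w /\ pedal_regular (cinv c w).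
Proof. by move=> [p [cp rp] <-]; rewrite cmapK //; split => //; exact: zdomP. Qed.

Lemma open_coord_regular c : open (coord_image c pedal_regular).
Proof.
rewrite openE => w /coord_regularP[zw rw]; rewrite /interior.
apply: filterS2 (near_cinv zw open_pedal_regular rw) (near_zdom zw) => u ru zu.
by exists (cinv c u); have [] := zdom_cinv zu.
Qed.

(** * The image of the surface in the sphere *)

Let y p := istereo (x p).

Lemma canonical_lift_chart c : atlas c -> canonical_lift y c (Ylift (chart_map c)).
Proof.
move=> ac; have oU := @zdom_open c; have sX := chart_smooth ac; have rp := chart_rho ac.
split=> [|w zw]; first exact: smooth_Ylift oU sX rp.
split; last exact: lorentz_canonical oU sX rp _ zw.
have q1 := sqnorm1_gt0 (chart_map c w).
(* The ratio of [lam_real] to the factor 2 / (1 + |x|^2) of [cone_istereo]. *)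
exists (lam_real (chart_map c) w * (1 + sqnorm (chart_map c w)) / 2).
  by rewrite divr_gt0 // mulr_gt0 // (lam_real_gt0 rp).
rewrite -[y (cinv c w)]/(istereo (chart_map c w)) cone_istereo scalerA /Ylift.
by congr (_ *: _); field; rewrite gt_eqF.
Qed.

Lemma hopf_chart c : atlas c ->
  hopf_schwarzian c (Ylift (chart_map c)) (schwarzian (chart_map c)) (kappa (chart_map
    c)).
Proof.
move=> ac; have oU := @zdom_open c; have sX := chart_smooth ac; have rp := chart_rho ac.
have zz := chart_XzXz ac; have zb := chart_XzXb ac.
split; [exact: smooth_schwarzian oU sX rp|exact: smooth_kappa oU sX rp|] => w zw; split.
  exact: kappa_perp oU sX zz rp zb _ zw.
exact: Lz_z oU sX zz rp _ zw.
Qed.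

Lemma willmore_stereo : willmore y.
Proof.
move=> c ac; exists (Ylift (chart_map c)), (schwarzian (chart_map c)), (kappa
  (chart_map c)).
split; [exact: canonical_lift_chart|exact: hopf_chart|] => w zw.
exact: frame_willmore (@zdom_open c) (chart_smooth ac) (chart_XzXz ac) (chart_rho ac)
  (chart_XzXb ac) _ zw.
Qed.

Lemma conformal_stereo : conformal_immersion y.
Proof.
split=> [c ac|c ac w zw]; first exact (smooth_stereo (@zdom_open c) (chart_smooth ac)).
have E s t := dot_vwd_stereo (@zdom_open c) (chart_smooth ac) s t zw.
rewrite /= vdz_wd vdzb_wd; split.
  by apply: (etrans (E dd dd)); rewrite (chart_XzXz ac zw) mulr0.
rewrite -[X in 0 < X]/(dot (vwd dd (stereo (chart_map c)) w)
  (vwd db (stereo (chart_map c)) w)) E.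
apply: mulr_gt0; last exact: chart_rho ac _ zw.
by rewrite exprn_gt0 // ltcR; exact: stereo_factor_gt0.
Qed.

Lemma willmore_immersion_stereo : willmore_immersion y.
Proof.
by split; [move=> p; exact: sphere_istereo|exact: conformal_stereo|exact:
  willmore_stereo].
Qed.

Lemma N_section_chart c : atlas c -> N_section c (Ylift (chart_map c)) (Nlift
  (chart_map c)).
Proof.
move=> ac; have oU := @zdom_open c; have sX := chart_smooth ac; have rp := chart_rho ac.
have zz := chart_XzXz ac; have zb := chart_XzXb ac.
split=> [|w zw]; first exact: smooth_Nlift oU sX rp.
split.
- exact: Nlift_bundle oU sX rp zb _ zw.
- exact: Nlift_null oU sX zz rp _ zw.
- exact: Nlift_Ylift oU sX zz rp _ zw.
- exact: Nlift_Lz oU sX zz rp _ zw.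
Qed.

Lemma smooth_pedal : smooth_map (fun p => istereo (pedal x x0 p)).
Proof.
move=> c ac; apply (smooth_stereo (@zdom_open c) (f := fun w => pedal x x0 (cinv c w))).
have sp := smooth_foot (@zdom_open c) (chart_smooth ac) (chart_rho ac) x0.
apply (@vsmooth_eq _ _ (@zdom_open c) _ _ _ (fun w zw => esym (pedal_chart ac zw)) sp).
Qed.

End Surface.

Theorem theorem7p1 (R : realType) (M : riemann_surface R) (n : nat)
  (x : M -> 'rV[R]_n) (hx : superconformal_minimal x) (x0 : 'rV[R]_n) :
  adjoint_transform (fun p => istereo (x p)) (fun p => istereo (pedal x x0 p)).
Proof.
split; [exact: willmore_immersion_stereo|by move=> p; exact: sphere_istereo
  |exact: smooth_pedal|].
exists (pedal_regular x x0); split.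
- exact: open_pedal_regular.
- exact: dense_pedal_regular.
move=> c ac; exists (Ylift (chart_map x c)), (Nlift (chart_map x c)), (schwarzian
  (chart_map x c)),
  (kappa (chart_map x c)).
split; [exact: canonical_lift_chart|exact: N_section_chart|exact: hopf_chart|].
have oU := @zdom_open R M c; have sX := chart_smooth hx ac; have rp := chart_rho hx ac.
have zz := chart_XzXz hx ac; have zb := chart_XzXb hx ac.
have oW : open (coord_image c (pedal_regular x x0)) by exact: open_coord_regular.
have WU : coord_image c (pedal_regular x x0) `<=` zdom c by move=> w /coord_regularP[].
have gW w : coord_image c (pedal_regular x x0) w -> foot_coef (chart_map x c) x0 w != 0.
  by move=> /coord_regularP[zw]; exact: foot_coef_chart_neq0.
exists (adjoint_mu (chart_map x c) x0); first exact (smooth_adjoint_mu oU sX rp oW WU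
  gW).
move=> w Ww eta Yhat; split.
(* The null vector Yhat is a multiple [k] of the paraboloid lift of the foot; [r] absorbs both [k]
   and the normalization of the cone. *)
- have [k k0 E] := adjoint_paraboloid oU sX zz rp WU gW Ww.
  have [r r0 Er] := paraboloid_cone (pedal x x0 (cinv c w)) k0.
  exists r => //; apply: (etrans E); rewrite -Er.
  by rewrite (pedal_chart hx x0 ac (WU _ Ww)).
- exact (riccati oU sX rp zb oW WU gW Ww).
- exact (eta_null oU sX zz rp zb (chart_XzzXzz hx ac) x0 WU Ww).
Qed.
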